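(* Consider the network of $q\ge 2$ units $$\dot x_i=Ax_i+\mu\sum_{k=1}^{\infty}\delta(t-kT)\,BK\Big(\sum_{j=1}^{q}\gamma_{ij}(x_j-x_i)\Big),\qquad i=1,\dots,q,$$ with $x_i\in\mathbb{R}^n$, $A\in\mathbb{R}^{n\times n}$, $B\in\mathbb{R}^{n\times 1}$, $K\in\mathbb{R}^{1\times n}$, $T>0$, $\mu>0$, weights $\gamma_{ij}\ge 0$ ($\gamma_{ii}=0$) and Laplacian $\Gamma\in\mathbb{R}^{q\times q}$. Assume that $(A,B)$ and $(e^{AT},B)$ are controllable pairs, that the directed graph of the network contains a spanning tree (equivalently, $\Gamma$ has a simple eigenvalue at $0$ and its other $q-1$ eigenvalues have strictly positive real parts), and that $$\left[(I-BK)e^{AT}\right]^n=0 .$$ Let the eigenvalues of $\Gamma$ be ordered as $0=\lambda_1<\mathrm{Re}(\lambda_2)\le\cdots\le\mathrm{Re}(\lambda_q)$. Let $N\in\mathbb{C}^{n\times n}$ be a strictly upper triangular matrix such that $Q^{H}\left[(I-BK)e^{AT}\right]Q=N$ for some unitary $Q\in\mathbb{C}^{n\times n}$. Suppose $$\mu>\frac{1}{\mathrm{Re}(\lambda_2)}\ln\left(\left\|BKe^{AT}\right\|\times\sum_{k=0}^{n-1}\|N\|^{k}\right).$$ Then the network is synchronous, i.e. $\|x_i(t)-x_j(t)\|\to 0$ as $t\to\infty$ for all pairs $(i,j)$ and all initial conditions.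
   Context: The Laplacian is $\Gamma\in\mathbb{R}^{q\times q}$ with off-diagonal entries $\Gamma_{ij}=-\gamma_{ij}$ ($i\ne j$) and diagonal entries $\Gamma_{ii}=\sum_{j}\gamma_{ij}$. $\|\cdot\|$ denotes the Euclidean norm of vectors and the induced 2-norm of matrices (with $\|N\|^0=1$); $Q^H$ is the conjugate transpose of $Q$; $\otimes$ is the Kronecker product; $I$ is the identity matrix of the appropriate size. Meaning of the impulsive dynamics ($\delta$ is the Dirac delta): write $x=[x_1^\top\ \cdots\ x_q^\top]^\top\in\mathbb{R}^{qn}$ and let $x(0)$ be the initial condition. A solution satisfies $\dot x(t)=[I\otimes A]x(t)$ for $t\ge 0$, $t\ne kT$ ($k=1,2,\dots$), and at each time $kT$, $k=1,2,\dots$, it jumps according to $x(kT^+)=e^{-\mu[\Gamma\otimes BK]}x(kT^-)$, where $x(kT^{\pm})$ are the one-sided limits. The value at the impulse times can be taken to be $x(kT^+)$. *)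

(* Defs.v *)
From HB Require Import structures.
From mathcomp Require Import all_boot all_order all_algebra.
From mathcomp Require Import all_classical all_reals all_analysis.
From mathcomp Require Import complex mxtens.
Set Implicit Arguments.
Unset Strict Implicit.
Unset Printing Implicit Defensive.
Import Order.TTheory GRing.Theory Num.Theory.
Import numFieldNormedType.Exports.
Local Open Scope classical_set_scope.
Local Open Scope ring_scope.

(* The limit is taken in the entrywise topology of 'M[R]_n. *)
Definition expmx (R : realType) (n : nat) (M : 'M[R]_n) : 'M[R]_n :=
  limn (series (fun k : nat => (k`!%:R)^-1 *: M ^+ k)).

(* The library norm on matrices is the max norm, hence the four definitions
   below. *)
Definition norm2 (R : realType) (n : nat) (v : 'cV[R]_n) : R :=
  Num.sqrt (\sum_(i < n) v i 0 ^+ 2).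

Definition opnorm2 (R : realType) (m n : nat) (M : 'M[R]_(m, n)) : R :=
  sup [set norm2 (M *m v) | v in [set v : 'cV[R]_n | norm2 v <= 1]].

Definition norm2C (R : realType) (n : nat) (v : 'cV[R[i]]_n) : R :=
  Num.sqrt (\sum_(i < n) Normc.normc (v i 0) ^+ 2).

Definition opnorm2C (R : realType) (m n : nat) (M : 'M[R[i]]_(m, n)) : R :=
  sup [set norm2C (M *m v) | v in [set v : 'cV[R[i]]_n | norm2C v <= 1]].

(* Kalman's condition: [B, AB, ..., A^(n-1) B] has full row rank. *)
Definition controllable (R : realType) (n m : nat)
    (A : 'M[R]_n) (B : 'M[R]_(n, m)) : Prop :=
  \rank (\mxrow_(k < n) (A ^+ k *m B)) = n.

Definition laplacian (R : realType) (q : nat) (gamma : 'M[R]_q) : 'M[R]_q :=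
  \matrix_(i, j) (if i == j then \sum_(k < q) gamma i k else - gamma i j).

(* The edge j -> i is present when unit i is driven by unit j. *)
Definition network_edge (R : realType) (q : nat) (gamma : 'M[R]_q) :
    rel 'I_q :=
  fun j i => 0 < gamma i j.

(* T is a directed tree spanning the graph E: edges point away from the root r,
   which has no parent, while every other node has exactly one. *)
Definition spanning_tree (q : nat) (E T : rel 'I_q) (r : 'I_q) : Prop :=
  [/\ subrel T E,
      forall j, ~~ T j r,
      forall i, i != r -> exists! j, T j i
    & forall i, connect T r i].

Definition has_spanning_tree (q : nat) (E : rel 'I_q) : Prop :=
  exists (T : rel 'I_q) (r : 'I_q), spanning_tree E T r.

Definition strictly_upper_triangular (F : nzRingType) (n : nat)
    (N : 'M[F]_n) : Prop :=
  forall i j : 'I_n, (j <= i)%N -> N i j = 0.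

(* The i-th block of x = [x_1; ...; x_q], in the indexing used by the Kronecker
   product *t. *)
Definition unit_state (R : realType) (q n : nat) (x : 'cV[R]_(q * n))
    (i : 'I_q) : 'cV[R]_n :=
  \col_(k < n) x (mxtens_index (i, k)) 0.

(* Trajectories are functions on R of which only the restriction to [0, +oo[
   matters; hence the one-sided derivative at the initial time. The impulse
   mu delta(t - kT) acts as the jump expmx (- mu (Gamma (x) BK)), and the value
   at an impulse time is the right limit. *)
Definition network_solution (R : realType) (q n : nat) (A : 'M[R]_n)
    (B : 'M[R]_(n, 1)) (K : 'M[R]_(1, n)) (T mu : R) (gamma : 'M[R]_q)
    (x0 : 'cV[R]_(q * n)) (x : R -> 'cV[R]_(q * n)) : Prop :=
  let F : 'M[R]_(q * n) := 1%:M *t A in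
  let J : 'M[R]_(q * n) := expmx (- mu *: (laplacian gamma *t (B *m K))) in
  [/\ x 0 = x0,
      h^-1 *: (x h - x 0) @[h --> 0^'+] --> F *m x 0,
      forall t : R, 0 < t -> (forall k : nat, (0 < k)%N -> t != k%:R * T) ->
        is_derive t 1 x (F *m x t)
    & forall k : nat, (0 < k)%N ->
        exists xm : 'cV[R]_(q * n),
          [/\ x t @[t --> (k%:R * T)^'-] --> xm,
              x t @[t --> (k%:R * T)^'+] --> J *m xm
            & x (k%:R * T) = J *m xm]].

Definition synchronous (R : realType) (q n : nat) (A : 'M[R]_n)
    (B : 'M[R]_(n, 1)) (K : 'M[R]_(1, n)) (T mu : R) (gamma : 'M[R]_q) : Prop :=
  forall (x0 : 'cV[R]_(q * n)) (x : R -> 'cV[R]_(q * n)),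
    network_solution A B K T mu gamma x0 x ->
    forall i j : 'I_q,
      norm2 (unit_state (x t) i - unit_state (x t) j) @[t --> +oo] --> (0 : R).

(* Main.v *)
(** Nilpotency of [(1 - BK) e^(AT)] forces [KB = 1], so [BK] is idempotent and
    the impulse acts as [1 (x) (1 - BK) + e^(-mu Gamma) (x) BK].  Let
    [M = (1 - BK) e^(AT)] and [L = BK e^(AT)].  Writing the states at time [kT]
    as the columns of [X_k], the sampled network reads
    [X_(k+1) = M X_k + L X_k (e^(-mu Gamma))^T].  Subtracting the first column
    from the others replaces [Gamma] by its quotient [Gamma'] by the constant
    vectors, whose eigenvalues are [lambda_2, ..., lambda_q]; a unitary change
    of basis then makes [e^(-mu Gamma')] triangular with diagonal entries of
    modulus [exp (- mu Re lambda_i)].  Unrolling the recursion over [n] steps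
    and using [M^n = 0], the mode [z] attached to [lambda_i] satisfies
    [z_(k+n) = \sum_(j < n) c M^j L z_(k+n-1-j) + (earlier modes)] with
    [|c| = exp (- mu Re lambda_i)].  Since [M] is unitarily similar to [N], the
    bound on [mu] makes this a delayed contraction with a vanishing forcing. *)

Require Import Defs.
From HB Require Import structures.
From mathcomp Require Import all_boot all_order all_algebra.
From mathcomp Require Import all_classical all_reals all_analysis.
From mathcomp Require Import complex mxtens.
From mathcomp Require Import ring lra.
Set Implicit Arguments.
Unset Strict Implicit.
Unset Printing Implicit Defensive.
Import Order.TTheory GRing.Theory Num.Theory.
Import numFieldNormedType.Exports.
Local Open Scope ring_scope.
Local Open Scope classical_set_scope.
Local Notation normc := Normc.normc.

(** * The matrix exponential *)

Lemma cvg_mx (K : numFieldType) (T : Type) (F : set_system T) (m n : nat)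
    (f : T -> 'M[K]_(m, n)) (M : 'M[K]_(m, n)) : Filter F ->
  (forall i j, f x i j @[x --> F] --> M i j) -> f x @[x --> F] --> M.
Proof.
move=> FF fM A [P MP sPA]; rewrite /nbhs /=.
have : \forall x \near F, forall i j, P i j (f x i j).
  apply: filter_forall => i; apply: filter_forall => j.
  by have := fM i j _ (MP i j).
by apply: filterS => x Px; apply: sPA.
Qed.

Lemma cvg_mx_coord (K : numFieldType) (T : Type) (F : set_system T) (m n : nat)
    (f : T -> 'M[K]_(m, n)) (M : 'M[K]_(m, n)) i j : Filter F ->
  f x @[x --> F] --> M -> f x i j @[x --> F] --> M i j.
Proof.
move=> FF fM; apply: (cvg_comp f (fun N : 'M[K]_(m, n) => N i j) fM).
exact: coord_continuous.
Qed.

Lemma cvg_bigsum (K : numFieldType) (T I : Type) (F : set_system T)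
    (r : seq I) (f : I -> T -> K) (l : I -> K) : Filter F ->
  (forall i, f i x @[x --> F] --> l i) ->
  \sum_(i <- r) f i x @[x --> F] --> \sum_(i <- r) l i.
Proof. by move=> FF fl; apply: cvg_big => //; exact: add_continuous. Qed.

Section Expmx.
Variables (R : realType) (n : nat).
Implicit Types (M : 'M[R]_n) (i j : 'I_n).

(** The entrywise l1 norm is submultiplicative and dominates each entry, so it compares the matrix
    exponential series with the scalar one. *)
Definition mx_l1 M : R := \sum_i \sum_j `|M i j|.

Lemma normr_expr_mx_le M k i j : `|(M ^+ k) i j| <= mx_l1 M ^+ k.
Proof.
elim: k i j => [|k IHk] i j.
  by rewrite !expr0 mxE; case: eqP => _; rewrite ?normr1 ?normr0.
rewrite exprS mxE (le_trans (ler_norm_sum _ _ _))// exprS.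
apply: (@le_trans _ _ ((\sum_l `|M i l|) * mx_l1 M ^+ k)).
  by rewrite mulr_suml ler_sum// => l _; rewrite normrM ler_wpM2l.
rewrite ler_wpM2r//; first by rewrite exprn_ge0// !sumr_ge0// => *; rewrite sumr_ge0.
by rewrite /mx_l1 [leRHS](bigD1 i)//= lerDl sumr_ge0// => *; rewrite sumr_ge0.
Qed.

Lemma mx_l1_ge0 M : 0 <= mx_l1 M.
Proof. by rewrite sumr_ge0// => *; rewrite sumr_ge0. Qed.

Lemma is_cvg_expmx_coord M i j :
  cvgn (series (fun k => (k`!%:R)^-1 * (M ^+ k) i j)).
Proof.
apply: normed_cvg; apply: series_le_cvg (is_cvg_series_exp_coeff (mx_l1 M)).
- by move=> k /=; exact: normr_ge0.
- by move=> k; exact/exp_coeff_ge0/mx_l1_ge0.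
move=> k /=; rewrite /exp_coeff /= normrM mulrC [`|_^-1|]ger0_norm ?invr_ge0//.
by rewrite ler_wpM2r ?invr_ge0//; exact: normr_expr_mx_le.
Qed.

(** A [limn] is meaningful only once convergence is known; the entrywise limits, obtained by
    domination, provide it. *)
Lemma cvg_expmx M : series (fun k => (k`!%:R)^-1 *: M ^+ k) @ \oo --> expmx M.
Proof.
rewrite /expmx; set S := series _.
have SM : S @ \oo --> (\matrix_(i, j) limn (fun k => S k i j) : 'M[R]_n).
  apply: cvg_mx => i j; rewrite mxE.
  have -> : (fun k => S k i j) = series (fun k => (k`!%:R)^-1 * (M ^+ k) i j).
    by apply/funext => k; rewrite /S /series /= summxE; apply: eq_bigr => l _; rewrite mxE.
  exact: is_cvg_expmx_coord.
by apply/cvg_ex; exists (\matrix_(i, j) limn (fun k => S k i j)).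
Qed.

Lemma cvg_expmx_coord M i j :
  series (fun k => (k`!%:R)^-1 * (M ^+ k) i j) @ \oo --> expmx M i j.
Proof.
rewrite [X in X @ _](_ : _ =
    fun k => (series (fun k => (k`!%:R)^-1 *: M ^+ k) k : 'M[R]_n) i j).
  by apply: cvg_mx_coord; exact: cvg_expmx.
by apply/funext => k; rewrite /series /= summxE; apply: eq_bigr => l _; rewrite mxE.
Qed.

Lemma linear_mx_continuous (f : {linear 'M[R]_n -> R^o}) (T : Type)
    (F : set_system T) (u : T -> 'M[R]_n) M : Filter F ->
  u x @[x --> F] --> M -> f (u x) @[x --> F] --> (f M : R).
Proof.
move=> FF uM.
have fE X : f X = \sum_i \sum_j X i j * f (delta_mx i j).
  rewrite {1}(matrix_sum_delta X) linear_sum; apply: eq_bigr => i _.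
  by rewrite linear_sum; apply: eq_bigr => j _; rewrite linearZ.
rewrite (fE M) [X in X @ _](_ : _ =
    fun x => \sum_i \sum_j u x i j * f (delta_mx i j)); last first.
  by apply/funext => x; rewrite (fE (u x)).
apply: cvg_bigsum => i; apply: cvg_bigsum => j.
by apply: cvgMr_tmp; apply: cvg_mx_coord.
Qed.

(** The partial sums lie in the kernel of [f], which is closed because [f] is a finite combination
    of entries. This carries vanishing entries from powers to the exponential. *)
Lemma linear_expmx_eq0 (f : {linear 'M[R]_n -> R^o}) M :
  (forall k, f (M ^+ k) = 0) -> f (expmx M) = 0.
Proof.
move=> fM;
have : (fun k => f (series (fun k => (k`!%:R)^-1 *: M ^+ k) k) : R) @ \oo -->
    (f (expmx M) : R).
  by apply: linear_mx_continuous; exact: cvg_expmx.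
rewrite [X in X @ _](_ : _ = fun=> 0); last first.
  by apply/funext => k; rewrite /series /= linear_sum big1// => l _; rewrite linearZ_LR fM scaler0.
by move=> /(cvg_unique _ (cvg_cst 0)) <-.
Qed.

Lemma expmx0 : expmx (0 : 'M[R]_n) = 1%:M.
Proof.
apply/matrixP => i j; have /cvg_unique := @cvg_expmx_coord 0 i j; apply => //.
(* The empty partial sum is 0, so the sequence is constant only from index 1 on. *)
apply: cvg_near_cst; near=> k; have [m ->] : exists m, k = m.+1.
  by exists k.-1; rewrite prednK//; near: k; exists 1%N.
rewrite /series /= big_nat_recl//= big1 ?addr0 => [|l _].
  by rewrite fact0 invr1 mul1r expr0.
by rewrite expr0n/= mxE mulr0.
Unshelve. all: by end_near. Qed.

End Expmx.

(** The relation passes to powers, then to partial sums, then to the limit. [D] may be rectangular,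
    so that the lemma covers commutation, projections and quotient maps alike. *)
Lemma expmx_intertwine (R : realType) (m n : nat) (D : 'M[R]_(m, n))
    (M : 'M[R]_n) (M' : 'M[R]_m) :
  D *m M = M' *m D -> D *m expmx M = expmx M' *m D.
Proof.
move=> DM; have DMk k : D *m M ^+ k = M' ^+ k *m D.
  elim: k => [|k IHk]; first by rewrite !expr0 mulmx1 mul1mx.
  by rewrite [in LHS]exprSr [in RHS]exprSr mulmxA IHk -mulmxA DM mulmxA.
apply/matrixP => i j; rewrite !mxE.
have l1 : (fun k => \sum_l D i l *
    series (fun k => (k`!%:R)^-1 * (M ^+ k) l j) k) @ \oo
    --> \sum_l D i l * expmx M l j.
  by apply: cvg_bigsum => l; apply: cvgMl_tmp; apply: cvg_expmx_coord.
have l2 : (fun k => \sum_l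
    series (fun k => (k`!%:R)^-1 * (M' ^+ k) i l) k * D l j) @ \oo
    --> \sum_l expmx M' i l * D l j.
  by apply: cvg_bigsum => l; apply: cvgMr_tmp; apply: cvg_expmx_coord.
apply: (cvg_unique _ l1); rewrite //.
rewrite (_ : (fun k => _) = (fun k => \sum_l
    series (fun k => (k`!%:R)^-1 * (M' ^+ k) i l) k * D l j))//.
apply/funext => k.
transitivity ((\sum_(0 <= l < k) (l`!%:R)^-1 *: (D *m M ^+ l)) i j).
  rewrite summxE; under eq_bigr do rewrite mulr_sumr.
  rewrite exchange_big/=; apply: eq_bigr => a _; rewrite !mxE mulr_sumr.
  by apply: eq_bigr => b _; rewrite mulrCA.
rewrite summxE; under [RHS]eq_bigr do rewrite mulr_suml.
rewrite [RHS]exchange_big/=; apply: eq_bigr => a _; rewrite DMk !mxE mulr_sumr.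
by apply: eq_bigr => b _; rewrite mulrA.
Qed.

(** * Derivatives of the exponential and linear differential equations *)

Lemma is_derive_bigsum (R : realType) (n : nat) (h : 'I_n -> R -> R)
    (dh : 'I_n -> R) (t : R) :
  (forall i, is_derive t 1 (h i) (dh i)) ->
  is_derive t 1 (fun s => \sum_i h i s) (\sum_i dh i).
Proof.
move=> hd; rewrite (_ : (fun s => _) = \sum_i h i); first exact: is_derive_sum.
by apply/funext => s; rewrite fct_sumE.
Qed.

Lemma is_derive_mul (R : realType) (f g : R -> R) (df dg t : R) :
  is_derive t 1 f df -> is_derive t 1 g dg ->
  is_derive t 1 (fun s => f s * g s) (df * g t + f t * dg).
Proof.
move=> fd gd; apply: (@is_derive_eq _ _ _ (f * g)).
by rewrite addrC /GRing.scale/= [g t * _]mulrC.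
Qed.

Lemma expr_scalemx (R : comNzRingType) (n : nat) (t : R) (M : 'M[R]_n) k :
  (t *: M) ^+ k = t ^+ k *: M ^+ k.
Proof.
elim: k => [|k IHk]; first by rewrite !expr0 scale1r.
by rewrite !exprS IHk -!mulmxE -scalemxAl -scalemxAr scalerA.
Qed.

(** Formal differentiation absorbs one factor [M] into [N]; thanks to this free left factor, one
    convergence lemma serves all derivatives of the series. *)
Lemma pseries_diffs_expmx (R : realType) (m n : nat) (N : 'M[R]_(m, n)) (M : 'M[R]_n) i j :
  pseries_diffs (fun k => (k`!%:R)^-1 * (N *m M ^+ k) i j) =
  fun k => (k`!%:R)^-1 * ((N *m M) *m M ^+ k) i j.
Proof.
apply/funext => k; rewrite /pseries_diffs exprS mulrA factS natrM invfM mulVKf ?pnatr_eq0//.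
by rewrite -mulmxA.
Qed.

Lemma cvg_pseries_expmx (R : realType) (m n : nat) (N : 'M[R]_(m, n)) (M : 'M[R]_n) i j (t : R) :
  pseries (fun k => (k`!%:R)^-1 * (N *m M ^+ k) i j) t @ \oo -->
  (N *m expmx (t *: M)) i j.
Proof.
rewrite mxE [X in X @ _](_ : _ = fun k => \sum_l N i l *
    series (fun k => (k`!%:R)^-1 * ((t *: M) ^+ k) l j) k).
  by apply: cvg_bigsum => l; apply: cvgMl_tmp; exact: cvg_expmx_coord.
apply/funext => k; rewrite /pseries /series /=.
under [RHS]eq_bigr do rewrite mulr_sumr.
rewrite exchange_big/=; apply: eq_bigr => p _; rewrite mxE mulr_sumr mulr_suml.
apply: eq_bigr => l _; rewrite expr_scalemx mxE; ring.
Qed.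

Lemma is_derive_mulmx_expmx (R : realType) (m n : nat) (N : 'M[R]_(m, n))
    (M : 'M[R]_n) i j (t : R) :
  is_derive t 1 (fun s => (N *m expmx (s *: M)) i j)
    ((N *m M *m expmx (t *: M)) i j).
Proof.
rewrite (_ : (fun s => _) =
    fun s => limn (pseries (fun k => (k`!%:R)^-1 * (N *m M ^+ k) i j) s)); last first.
  by apply/funext => s; apply/esym/cvg_lim => //; exact: cvg_pseries_expmx.
have dE := pseries_diffs_expmx N M i j.
(* Termwise differentiation at [t] asks for convergence of the series and of its first two formal
   derivatives at a point of larger modulus, here [|t| + 1]. *)
apply: (is_derive_eq (pseries_snd_diffs (K := `|t| + 1) _ _ _ _)).
- by apply/cvg_ex; eexists; exact: cvg_pseries_expmx.
- by rewrite dE; apply/cvg_ex; eexists; exact: cvg_pseries_expmx.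
- rewrite dE pseries_diffs_expmx; apply/cvg_ex; eexists; exact: cvg_pseries_expmx.
- by rewrite [ltRHS]ger0_norm ?addr_ge0// ltrDl.
by rewrite dE; apply/cvg_lim => //; exact: cvg_pseries_expmx.
Qed.

Lemma is_derive_expmx (R : realType) (n : nat) (M : 'M[R]_n) i j (t : R) :
  is_derive t 1 (fun s => expmx (s *: M) i j) ((M *m expmx (t *: M)) i j).
Proof.
have := is_derive_mulmx_expmx 1%:M M i j t; rewrite mul1mx.
by under eq_fun do rewrite mul1mx.
Qed.

Lemma is_derive_linear_expmx (R : realType) (n : nat)
    (f : {linear 'M[R]_n -> R^o}) (M : 'M[R]_n) (t : R) :
  is_derive t 1 (fun s => f (expmx (s *: M)) : R) (f (M *m expmx (t *: M)) : R).
Proof.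
have fE X : f X = \sum_i \sum_j X i j * f (delta_mx i j).
  rewrite {1}(matrix_sum_delta X) linear_sum; apply: eq_bigr => i _.
  by rewrite linear_sum; apply: eq_bigr => j _; rewrite linearZ.
under eq_fun do rewrite fE; rewrite (fE (_ *m _)).
apply: is_derive_bigsum => i; apply: is_derive_bigsum => j.
apply: (is_derive_eq (is_derive_mul (is_derive_expmx M i j t) (is_derive_cst _ _ _))).
by rewrite mulr0 addr0.
Qed.

Lemma comm_expmx (R : realType) (n : nat) (M : 'M[R]_n) (t : R) :
  M *m expmx (t *: M) = expmx (t *: M) *m M.
Proof. by apply: expmx_intertwine; rewrite -scalemxAl -scalemxAr. Qed.

(** The two terms of the product rule cancel since [M] commutes with its exponential. With [x] the
    exponential this gives its inverse; with [x] a trajectory, uniqueness of solutions. *)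
Lemma is_derive_expmxN_mul (R : realType) (n p : nat) (M : 'M[R]_n)
    (x : R -> 'M[R]_(n, p)) (t : R) i j :
  (forall l, is_derive t 1 (fun s => x s l j) ((M *m x t) l j)) ->
  is_derive t 1 (fun s => (expmx (s *: - M) *m x s) i j) 0.
Proof.
move=> xd; under eq_fun do rewrite mxE.
apply: (is_derive_eq (is_derive_bigsum (fun l =>
  is_derive_mul (is_derive_expmx (- M) i l t) (xd l)))).
rewrite big_split/=.
have -> : \sum_l (- M *m expmx (t *: - M)) i l * x t l j =
    (- M *m expmx (t *: - M) *m x t) i j by rewrite [RHS]mxE.
have -> : \sum_l expmx (t *: - M) i l * (M *m x t) l j =
    (expmx (t *: - M) *m (M *m x t)) i j by rewrite [RHS]mxE.
by rewrite comm_expmx mulmxN mulNmx mulmxA mxE addNr.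
Qed.

Lemma expmxN_mul (R : realType) (n : nat) (M : 'M[R]_n) :
  expmx (- M) *m expmx M = 1%:M.
Proof.
apply/matrixP => i j.
have d0 (t : R) : is_derive t 1 (fun s : R => (expmx (s *: - M) *m expmx (s *: M)) i j) 0.
  by apply: is_derive_expmxN_mul => l; exact: is_derive_expmx.
have := is_derive_0_is_cst 1 0 d0.
by rewrite !scale1r !scale0r expmx0 mul1mx.
Qed.

Lemma expmx_mulN (R : realType) (n : nat) (M : 'M[R]_n) :
  expmx M *m expmx (- M) = 1%:M.
Proof. by rewrite -{1}[M]opprK expmxN_mul. Qed.

Lemma is_derive1_continuous (R : realType) (f : R -> R) (t df : R) :
  is_derive t 1 f df -> {for t, continuous f}.
Proof.
by move=> [fd _]; apply: differentiable_continuous; apply/derivable1_diffP.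
Qed.

Lemma is_derive_0_itv (R : realType) (f : R -> R) (a b s t : R) :
  (forall u, a < u < b -> is_derive u 1 f 0) -> a < s -> s <= t -> t < b ->
  f s = f t.
Proof.
move=> fd as_ st tb.
have fd' u : s <= u <= t -> is_derive u 1 f 0.
  by move=> /andP[su ut]; apply: fd; rewrite (lt_le_trans as_ su) (le_lt_trans ut tb).
have [] := @MVT_segment R f (fun=> 0) s t st.
- by move=> u; rewrite in_itv/= => /andP[/ltW su /ltW ut]; apply: fd'; rewrite su.
- apply: continuous_in_subspaceT => u; rewrite inE/= in_itv/= => sut.
  exact: is_derive1_continuous (fd' _ sut).
by move=> c _ /eqP; rewrite mul0r subr_eq0 => /eqP.
Qed.

Lemma is_derive_shift1 (R : realType) (f : R -> R) (a t df : R) :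
  is_derive (t + a) 1 f df -> is_derive t 1 (fun s => f (s + a)) df.
Proof.
move=> fd; have := @is_derive1_comp _ f (fun s => s + a) t df 1 fd.
rewrite mulr1; apply; apply: (is_derive_eq (is_deriveD _ _)).
by rewrite addr0.
Qed.

Lemma expmx_shift_continuous (R : realType) (n : nat) (M : 'M[R]_n) i j (a t : R) :
  {for t, continuous (fun s => expmx ((s - a) *: M) i j)}.
Proof.
apply: is_derive1_continuous.
exact: (@is_derive_shift1 _ (fun s => expmx (s *: M) i j) (- a) t _
  (is_derive_expmx M i j (t - a))).
Qed.

(** On []a, b[] the function [y] has zero derivative, and its constant value is read off from the
    right limit at [a]; nothing is required of [x] to the left of [a]. *)
Lemma linear_ode_solution (R : realType) (n : nat) (F : 'M[R]_n)
    (x : R -> 'cV[R]_n) (a b : R) :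
  x t @[t --> a^'+] --> x a ->
  (forall t, a < t < b -> is_derive t 1 x (F *m x t)) ->
  forall t, a < t < b -> x t = expmx ((t - a) *: F) *m x a.
Proof.
move=> xa xd t /andP[at_ tb].
have xdc u l : a < u < b -> is_derive u 1 (fun s => x s l 0) ((F *m x u) l 0).
  move=> aub; have [xD xE] := xd u aub; split.
    by move/derivable_mxP : xD; exact.
  by rewrite -xE derive_mx// mxE.
pose y s := expmx ((s - a) *: - F) *m x s.
have yd u i : a < u < b -> is_derive u 1 (fun s => y s i 0) 0.
  move=> aub.
  have /is_derive_shift1 : is_derive (u - a) 1
      (fun s => (expmx (s *: - F) *m x (s + a)) i 0) 0.
    apply: is_derive_expmxN_mul => l; apply: (@is_derive_shift1 R (fun s => x s l 0)).
    by rewrite subrK; exact: xdc.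
  by under eq_fun do rewrite subrK.
have yt : y t = x a.
  apply/colP => i.
  have l1 : y s i 0 @[s --> a^'+] --> x a i 0.
    rewrite -[x a]mul1mx -(@expmx0 R n) -(scale0r (- F)) -(subrr a) mxE.
    under eq_fun do rewrite mxE.
    apply: cvg_bigsum => l; apply: cvgM; last exact: (@cvg_mx_coord _ _ _ _ _ x (x a) l 0 _ xa).
    apply: cvg_at_right_filter.
    exact: expmx_shift_continuous.
  have l2 : y s i 0 @[s --> a^'+] --> y t i 0.
    apply: cvg_near_cst; near=> s.
    apply: (is_derive_0_itv (fun u => yd u i)) => //.
    by apply: ltW; near: s; exact: nbhs_right_lt.
  by apply: (cvg_unique _ l2 l1).
by rewrite -yt mulmxA scalerN expmx_mulN mul1mx.
Unshelve. all: by end_near. Qed.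

(** * Euclidean norms *)

(** Lagrange's identity: twice the defect is the double sum of [(f i * g j - f j * g i) ^+ 2]. *)
Lemma cauchy_schwarz_sum (R : rcfType) (I : finType) (f g : I -> R) :
  (\sum_i f i * g i) ^+ 2 <= (\sum_i f i ^+ 2) * (\sum_i g i ^+ 2).
Proof.
rewrite -subr_ge0 -(@pmulr_rge0 _ 2)//.
have -> : 2 * ((\sum_i f i ^+ 2) * (\sum_i g i ^+ 2) - (\sum_i f i * g i) ^+ 2) =
    \sum_i \sum_j (f i * g j - f j * g i) ^+ 2.
  have E1 : (\sum_i f i ^+ 2) * (\sum_i g i ^+ 2) = \sum_i \sum_j (f i * g j) ^+ 2.
    rewrite mulr_suml; apply: eq_bigr => i _; rewrite mulr_sumr.
    by apply: eq_bigr => j _; rewrite exprMn.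
  have E2 : (\sum_i f i ^+ 2) * (\sum_i g i ^+ 2) = \sum_i \sum_j (f j * g i) ^+ 2.
    by rewrite E1 exchange_big.
  have E3 : (\sum_i f i * g i) ^+ 2 = \sum_i \sum_j (f i * g j) * (f j * g i).
    rewrite expr2 mulr_suml; apply: eq_bigr => i _; rewrite mulr_sumr.
    by apply: eq_bigr => j _; rewrite mulrACA [g i * _]mulrC mulrACA -mulrA.
  rewrite mulrBr mulr_natl mulr2n {1}E1 E2 E3 mulr_natl mulr2n opprD.
  rewrite -!big_split/= -!sumrN -!big_split/=; apply: eq_bigr => i _.
  rewrite -!big_split/= -!sumrN -!big_split/=; apply: eq_bigr => j _; ring.
by rewrite sumr_ge0// => i _; rewrite sumr_ge0// => j _; rewrite sqr_ge0.
Qed.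

Lemma sqrt_sum_sqrD (R : rcfType) (I : finType) (f g : I -> R) :
  Num.sqrt (\sum_i (f i + g i) ^+ 2) <=
  Num.sqrt (\sum_i f i ^+ 2) + Num.sqrt (\sum_i g i ^+ 2).
Proof.
set a := \sum_i f i ^+ 2; set b := \sum_i g i ^+ 2.
have a0 : 0 <= a by rewrite sumr_ge0// => i _; exact: sqr_ge0.
have b0 : 0 <= b by rewrite sumr_ge0// => i _; exact: sqr_ge0.
rewrite -ler_sqr ?nnegrE ?addr_ge0 ?sqrtr_ge0//.
rewrite sqr_sqrtr; last by rewrite sumr_ge0// => i _; exact: sqr_ge0.
rewrite sqrrD !sqr_sqrtr//.
have -> : \sum_i (f i + g i) ^+ 2 = a + (\sum_i f i * g i) *+ 2 + b.
  rewrite /a /b -sumrMnl -!big_split/=; apply: eq_bigr => i _.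
  by rewrite sqrrD.
rewrite lerD2r lerD2l lerMn2r/= -sqrtrM// (le_trans (ler_norm _))//.
by rewrite -sqrtr_sqr ler_wsqrtr// cauchy_schwarz_sum.
Qed.

Section Norm2C.
Variable R : realType.
Local Notation C := R[i].

Lemma normc_ge0 (z : C) : 0 <= normc z.
Proof. by case: z => a b; exact: sqrtr_ge0. Qed.

Lemma normcE (z : C) : `|z| = (normc z)%:C%C.
Proof. by []. Qed.

Lemma normcD (z w : C) : normc (z + w) <= normc z + normc w.
Proof. exact: le_normcD. Qed.

Lemma normc_sqr (z : C) : normc z ^+ 2 = complex.Re z ^+ 2 + complex.Im z ^+ 2.
Proof. by case: z => a b /=; rewrite sqr_sqrtr// addr_ge0// sqr_ge0. Qed.

Lemma normc_sum (I : Type) (r : seq I) (f : I -> C) :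
  normc (\sum_(i <- r) f i) <= \sum_(i <- r) normc (f i).
Proof.
elim: r => [|i r IHr]; first by rewrite !big_nil Normc.normc0.
by rewrite !big_cons (le_trans (normcD _ _))// lerD2l.
Qed.

Lemma norm2C_ge0 n (v : 'cV[C]_n) : 0 <= norm2C v.
Proof. exact: sqrtr_ge0. Qed.

Lemma norm2C_sqr n (v : 'cV[C]_n) : norm2C v ^+ 2 = \sum_i normc (v i 0) ^+ 2.
Proof. by rewrite sqr_sqrtr// sumr_ge0// => i _; exact: sqr_ge0. Qed.

Lemma norm2_ge0 n (v : 'cV[R]_n) : 0 <= norm2 v.
Proof. exact: sqrtr_ge0. Qed.

Lemma norm2_sqr n (v : 'cV[R]_n) : norm2 v ^+ 2 = \sum_i v i 0 ^+ 2.
Proof. by rewrite sqr_sqrtr// sumr_ge0// => i _; exact: sqr_ge0. Qed.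

Lemma norm2C0 n : norm2C (0 : 'cV[C]_n) = 0.
Proof.
rewrite /norm2C big1 ?sqrtr0// => i _.
by rewrite mxE Normc.normc0 expr0n.
Qed.

Lemma norm20 n : norm2 (0 : 'cV[R]_n) = 0.
Proof. by rewrite /norm2 big1 ?sqrtr0// => i _; rewrite mxE expr0n. Qed.

Lemma norm2CD n (v w : 'cV[C]_n) : norm2C (v + w) <= norm2C v + norm2C w.
Proof.
apply: le_trans (sqrt_sum_sqrD _ _); apply: ler_wsqrtr; apply: ler_sum => i _.
by rewrite mxE ler_sqr ?nnegrE ?addr_ge0 ?normc_ge0 ?normcD.
Qed.

Lemma norm2C_sum n (I : Type) (r : seq I) (P : pred I) (f : I -> 'cV[C]_n) :
  norm2C (\sum_(i <- r | P i) f i) <= \sum_(i <- r | P i) norm2C (f i).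
Proof.
elim/big_rec2: _ => [|i x v _ vx]; first by rewrite norm2C0.
by rewrite (le_trans (norm2CD _ _))// lerD2l.
Qed.

Lemma norm2CZ n (c : C) (v : 'cV[C]_n) : norm2C (c *: v) = normc c * norm2C v.
Proof.
rewrite /norm2C -[normc c]ger0_norm ?normc_ge0// -sqrtr_sqr -sqrtrM ?sqr_ge0//.
by rewrite mulr_sumr; congr Num.sqrt; apply: eq_bigr => i _; rewrite mxE Normc.normcM exprMn.
Qed.

Lemma norm2Z n (c : R) (v : 'cV[R]_n) : norm2 (c *: v) = `|c| * norm2 v.
Proof.
rewrite /norm2 -sqrtr_sqr -sqrtrM ?sqr_ge0//.
by rewrite mulr_sumr; congr Num.sqrt; apply: eq_bigr => i _; rewrite mxE exprMn.
Qed.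

Lemma normc_coord_le n (v : 'cV[C]_n) i : normc (v i 0) <= norm2C v.
Proof.
rewrite -ler_sqr ?nnegrE ?normc_ge0 ?norm2C_ge0// norm2C_sqr (bigD1 i)//= lerDl.
by rewrite sumr_ge0// => j _; exact: sqr_ge0.
Qed.

Lemma normr_coord_le n (v : 'cV[R]_n) i : `|v i 0| <= norm2 v.
Proof.
rewrite -ler_sqr ?nnegrE ?norm2_ge0// norm2_sqr (bigD1 i)//= real_normK ?num_real// lerDl.
by rewrite sumr_ge0// => j _; exact: sqr_ge0.
Qed.

Lemma norm2_le_sum n (v : 'cV[R]_n) : norm2 v <= \sum_i `|v i 0|.
Proof.
rewrite -ler_sqr ?nnegrE ?norm2_ge0 ?sumr_ge0// norm2_sqr expr2 mulr_suml.
apply: ler_sum => i _; rewrite -real_normK ?num_real// expr2 ler_wpM2l//.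
by rewrite (bigD1 i)//= lerDl sumr_ge0.
Qed.

Lemma norm2C_le_sum n (v : 'cV[C]_n) : norm2C v <= \sum_i normc (v i 0).
Proof.
rewrite -ler_sqr ?nnegrE ?norm2C_ge0 ?sumr_ge0//; last by move=> *; exact: normc_ge0.
rewrite norm2C_sqr expr2 mulr_suml.
apply: ler_sum => i _; rewrite expr2 ler_wpM2l ?normc_ge0//.
by rewrite (bigD1 i)//= lerDl sumr_ge0// => *; exact: normc_ge0.
Qed.

(** [sup] is a least upper bound only for bounded sets; the sum of the moduli of the entries is a
    bound here. *)
Lemma has_ubound_norm2_mulmx m n (M : 'M[R]_(m, n)) :
  has_ubound [set norm2 (M *m v) | v in [set v : 'cV[R]_n | norm2 v <= 1]].
Proof.
exists (\sum_i \sum_j `|M i j|) => _ [w /= w1 <-].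
rewrite (le_trans (norm2_le_sum _))// ler_sum// => i _.
rewrite mxE (le_trans (ler_norm_sum _ _ _))// ler_sum// => j _.
by rewrite normrM ler_piMr// (le_trans (normr_coord_le _ _)).
Qed.

Lemma has_ubound_norm2C_mulmx m n (M : 'M[C]_(m, n)) :
  has_ubound [set norm2C (M *m v) | v in [set v : 'cV[C]_n | norm2C v <= 1]].
Proof.
exists (\sum_i \sum_j normc (M i j)) => _ [w /= w1 <-].
rewrite (le_trans (norm2C_le_sum _))// ler_sum// => i _.
rewrite mxE (le_trans (normc_sum _ _))// ler_sum// => j _.
by rewrite Normc.normcM ler_piMr ?normc_ge0// (le_trans (normc_coord_le _ _)).
Qed.

Lemma opnorm2_ge0 m n (M : 'M[R]_(m, n)) : 0 <= opnorm2 M.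
Proof.
apply: ub_le_sup; first exact: has_ubound_norm2_mulmx.
by exists 0; rewrite /= ?mulmx0 norm20.
Qed.

Lemma opnorm2C_ge0 m n (M : 'M[C]_(m, n)) : 0 <= opnorm2C M.
Proof.
apply: ub_le_sup; first exact: has_ubound_norm2C_mulmx.
by exists 0; rewrite /= ?mulmx0 norm2C0.
Qed.

Lemma norm2_mulmx_le m n (M : 'M[R]_(m, n)) (v : 'cV[R]_n) :
  norm2 (M *m v) <= opnorm2 M * norm2 v.
Proof.
have ub := has_ubound_norm2_mulmx M.
have [v0|vn0] := eqVneq (norm2 v) 0.
  have -> : v = 0.
    by apply/colP => i; rewrite mxE; apply/eqP; rewrite -normr_le0 -v0 normr_coord_le.
  by rewrite mulmx0 !norm20 mulr0.
have v0 : 0 < norm2 v by rewrite lt_def vn0 norm2_ge0.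
rewrite -ler_pdivrMr// mulrC -[(norm2 v)^-1]ger0_norm ?invr_ge0 ?norm2_ge0//.
rewrite -norm2Z scalemxAr; apply: ub_le_sup => //; exists ((norm2 v)^-1 *: v) => //=.
by rewrite norm2Z ger0_norm ?invr_ge0 ?norm2_ge0// mulVf.
Qed.

Lemma norm2C_mulmx_le m n (M : 'M[C]_(m, n)) (v : 'cV[C]_n) :
  norm2C (M *m v) <= opnorm2C M * norm2C v.
Proof.
have ub := has_ubound_norm2C_mulmx M.
have [v0|vn0] := eqVneq (norm2C v) 0.
  have -> : v = 0.
    apply/colP => i; rewrite mxE; apply: Normc.eq0_normc; apply/eqP.
    by rewrite eq_le normc_ge0 andbT -v0 normc_coord_le.
  by rewrite mulmx0 !norm2C0 mulr0.
have v0 : 0 < norm2C v by rewrite lt_def vn0 norm2C_ge0.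
have cE : normc ((norm2C v)^-1)%:C%C = (norm2C v)^-1.
  by rewrite /normc /= expr0n addr0 sqrtr_sqr ger0_norm// invr_ge0 norm2C_ge0.
rewrite -ler_pdivrMr// mulrC -cE.
rewrite -norm2CZ scalemxAr; apply: ub_le_sup => //.
by exists (((norm2C v)^-1)%:C%C *: v) => //=; rewrite norm2CZ cE mulVf.
Qed.

Lemma map_Re_mulmx m n p (M : 'M[R]_(m, n)) (V : 'M[C]_(n, p)) :
  map_mx (@complex.Re R) (map_mx (real_complex R) M *m V) =
  M *m map_mx (@complex.Re R) V.
Proof.
apply/matrixP => i k; rewrite !mxE raddf_sum; apply: eq_bigr => j _.
by rewrite !mxE; case: (V j k) => a b /=; rewrite mul0r subr0.
Qed.

Lemma map_Im_mulmx m n p (M : 'M[R]_(m, n)) (V : 'M[C]_(n, p)) :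
  map_mx (@complex.Im R) (map_mx (real_complex R) M *m V) =
  M *m map_mx (@complex.Im R) V.
Proof.
apply/matrixP => i k; rewrite !mxE raddf_sum; apply: eq_bigr => j _.
by rewrite !mxE; case: (V j k) => a b /=; rewrite mul0r addr0.
Qed.

(** A real matrix acts separately on real and imaginary parts, whose squared norms add up. Hence the
    real operator norm stays usable in complex coordinates. *)
Lemma norm2C_map_mulmx_le m n (M : 'M[R]_(m, n)) (v : 'cV[C]_n) :
  norm2C (map_mx (real_complex R) M *m v) <= opnorm2 M * norm2C v.
Proof.
have nE k (w : 'cV[C]_k) : norm2C w ^+ 2 =
    norm2 (map_mx (@complex.Re R) w) ^+ 2 + norm2 (map_mx (@complex.Im R) w) ^+ 2.
  rewrite norm2C_sqr !norm2_sqr -big_split/=.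
  by apply: eq_bigr => i _; rewrite normc_sqr !mxE.
rewrite -ler_sqr ?nnegrE ?mulr_ge0 ?norm2C_ge0 ?opnorm2_ge0//.
rewrite exprMn !nE map_Re_mulmx map_Im_mulmx mulrDr -!exprMn lerD// ler_sqr ?norm2_mulmx_le//;
  by rewrite nnegrE ?mulr_ge0 ?norm2_ge0 ?opnorm2_ge0.
Qed.

Lemma norm2C_unitary n (Q : 'M[C]_n) (v : 'cV[C]_n) :
  Q \is unitarymx -> norm2C (Q *m v) = norm2C v.
Proof.
move=> /unitarymxP QQ; have {}QQ := mulmx1C QQ.
have nE (w : 'cV[C]_n) : ((norm2C w ^+ 2)%:C)%C = ((w ^t*)%sesqui *m w) 0 0.
  rewrite norm2C_sqr mxE rmorph_sum; apply: eq_bigr => i _.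
  by rewrite !mxE mulrC -normCK normcE rmorphXn.
apply/eqP; rewrite -(@eqrXn2 _ 2) ?norm2C_ge0//; apply/eqP.
apply: (@complexI R); rewrite !nE trmx_mul map_mxM -mulmxA.
by rewrite [_ *m (Q *m v)]mulmxA QQ mul1mx.
Qed.
End Norm2C.

(** * Schur form of the exponential *)

(** [is_trig_mx] means lower triangular: a nonzero product [A i l * B l j] requires
    [j <= l <= i]. *)
Lemma is_trig_mulmx (F : nzRingType) (m : nat) (A B : 'M[F]_m) :
  is_trig_mx A -> is_trig_mx B -> is_trig_mx (A *m B).
Proof.
move=> /is_trig_mxP tA /is_trig_mxP tB; apply/is_trig_mxP => i j ij.
rewrite mxE big1// => l _; have [il|li] := ltnP i l; first by rewrite tA ?mul0r.
by rewrite tB ?mulr0// (leq_ltn_trans li).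
Qed.

Lemma is_trig_expr (F : nzRingType) (m : nat) (A : 'M[F]_m) k :
  is_trig_mx A -> is_trig_mx (A ^+ k).
Proof.
move=> tA; elim: k => [|k IHk]; first by rewrite expr0 scalar_mx_is_trig.
by rewrite exprS is_trig_mulmx.
Qed.

Lemma trig_mulmx_diag (F : nzRingType) (m : nat) (A B : 'M[F]_m) i :
  is_trig_mx A -> is_trig_mx B -> (A *m B) i i = A i i * B i i.
Proof.
move=> /is_trig_mxP tA /is_trig_mxP tB.
rewrite mxE (bigD1 i)//= big1 ?addr0// => l li.
have [il|{}li|/val_inj il] := ltngtP i l; first by rewrite tA ?mul0r.
  by rewrite tB ?mulr0.
by rewrite il eqxx in li.
Qed.

Lemma Re_mulc (R : rcfType) (z w : R[i]) :
  complex.Re (z * w) =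
  complex.Re z * complex.Re w - complex.Im z * complex.Im w.
Proof. by case: z w => [? ?] [? ?]. Qed.

Lemma Im_mulc (R : rcfType) (z w : R[i]) :
  complex.Im (z * w) =
  complex.Re z * complex.Im w + complex.Im z * complex.Re w.
Proof. by case: z w => [? ?] [? ?]. Qed.

Section SchurExp.
Variables (R : realType) (m : nat).
Local Notation C := R[i].
Implicit Types (V W : 'M[C]_m) (M : 'M[R]_m).

(** [expmx] is defined on real matrices, so the exponential is taken first and then carried to
    complex coordinates. [W] and [V] are independent so that [W] alone can be rescaled. *)
Definition cconj W V M : 'M[C]_m := W *m map_mx (real_complex R) M *m V.

Definition re_cconj W V i j M : R^o := complex.Re (cconj W V M i j).

Lemma re_cconj_is_linear W V i j : linear (re_cconj W V i j).
Proof.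
move=> a M N; rewrite /re_cconj /cconj map_mxD mulmxDr mulmxDl mxE raddfD/=.
congr (_ + _); rewrite map_mxZ -scalemxAr -scalemxAl mxE.
by case: (_ i j) => x y /=; rewrite mul0r subr0.
Qed.

Definition lin_re_cconj W V i j : {linear 'M[R]_m -> R^o} :=
  HB.pack (re_cconj W V i j)
    (GRing.isLinear.Build R 'M[R]_m R^o _ (re_cconj W V i j)
       (re_cconj_is_linear W V i j)).

(** Multiplication by [- 'i] turns an imaginary part into a real part, so facts on the real linear
    forms [re_cconj] cover both. *)
Lemma im_cconjE W V i j M :
  complex.Im (cconj W V M i j) = re_cconj (- 'i%C *: W) V i j M.
Proof.
rewrite /re_cconj /cconj -!scalemxAl [in RHS]mxE mulNr raddfN; case: (_ i j) => x y /=.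
by rewrite mul0r mul1r sub0r opprK.
Qed.

Variables (W : 'M[C]_m) (M : 'M[R]_m).
Hypothesis WU : W \is unitarymx.
Let V := (W ^t*)%sesqui.
Let U := cconj W V M.
Hypothesis Utrig : is_trig_mx U.

Let WV : W *m V = 1%:M. Proof. exact/unitarymxP. Qed.
Let VW : V *m W = 1%:M. Proof. exact: mulmx1C WV. Qed.

Lemma cconjM (A B : 'M[R]_m) : cconj W V (A *m B) = cconj W V A *m cconj W V B.
Proof. by rewrite /cconj map_mxM !mulmxA -(mulmxA _ V W) VW mulmx1. Qed.

Lemma cconjX k : cconj W V (M ^+ k) = U ^+ k.
Proof.
elim: k => [|k IHk]; first by rewrite !expr0 /cconj map_mx1 mulmx1 WV.
by rewrite !exprS -!mulmxE cconjM IHk.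
Qed.

(** Powers of [s *: M] become multiples of powers of [U], which vanish above the diagonal; real and
    imaginary parts of an entry are linear forms, so [linear_expmx_eq0] applies. *)
Lemma cconj_expmx_trig s : is_trig_mx (cconj W V (expmx (s *: M))).
Proof.
apply/is_trig_mxP => i j ij; apply/eqP; rewrite eq_complex /=; apply/andP.
have X0 k : cconj W V ((s *: M) ^+ k) i j = 0.
  rewrite expr_scalemx /cconj map_mxZ -scalemxAr -scalemxAl -/(cconj _ _ _) cconjX mxE.
  by rewrite (is_trig_mxP (is_trig_expr k Utrig))// mulr0.
split; apply/eqP.
  by apply: (linear_expmx_eq0 (f := lin_re_cconj W V i j)) => k; rewrite /= /re_cconj X0.
rewrite im_cconjE.
by apply: (linear_expmx_eq0 (f := lin_re_cconj _ V i j)) => k /=; rewrite -im_cconjE X0.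
Qed.

(* By triangularity the diagonal entry e(s) solves e' = U_ii e, so that
   |e(s)|^2 exp(- 2 s Re U_ii) is constant. *)
Lemma normc_cconj_expmx s i :
  normc (cconj W V (expmx (s *: M)) i i) = expR (s * complex.Re (U i i)).
Proof.
pose E s := cconj W V (expmx (s *: M)) i i.
pose al := complex.Re (U i i); pose be := complex.Im (U i i).
pose a (s : R) : R := complex.Re (E s); pose b (s : R) : R := complex.Im (E s).
have E' t : cconj W V (M *m expmx (t *: M)) i i = U i i * E t.
  rewrite cconjM trig_mulmx_diag; [reflexivity|exact: Utrig|].
  exact: cconj_expmx_trig.
have ad t : is_derive t (1:R) a (al * a t - be * b t).
  apply: (is_derive_eq (is_derive_linear_expmx (lin_re_cconj W V i i) M t)).
  by rewrite /= /re_cconj E' Re_mulc.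
have bd t : is_derive t (1:R) b (al * b t + be * a t).
  rewrite (_ : b = fun s => re_cconj (- 'i%C *: W) V i i (expmx (s *: M))); last first.
    by apply/funext => u; rewrite -im_cconjE.
  apply: (is_derive_eq (is_derive_linear_expmx (lin_re_cconj _ V i i) M t)).
  by rewrite /= -!im_cconjE E' Im_mulc.
have hd t : is_derive t (1:R)
    (fun s => (a s * a s + b s * b s) * expR (- (2 * al) * s)) 0.
  have ed : is_derive t (1:R) (fun s => expR (- (2 * al) * s))
      (- (2 * al) * expR (- (2 * al) * t)).
    apply: (is_derive_eq (@is_derive1_comp _ expR (fun s => - (2 * al) * s) t _ _
      (is_derive_expR _) (is_derive_mul (is_derive_cst (- (2 * al)) t (1 : R))
        (is_derive_id t (1 : R))))).
    by rewrite mul0r add0r mulr1 mulrC.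
  have abd : is_derive t (1:R) (fun s => a s * a s + b s * b s)
     (2 * al * (a t * a t + b t * b t)).
    apply: (is_derive_eq (is_deriveD (is_derive_mul (ad t) (ad t)) (is_derive_mul (bd t) (bd t)))).
    by move: (a t) (b t) (al) (be) => *; ring.
  apply: (is_derive_eq (is_derive_mul abd ed)).
  by move: (a t) (b t) (al) (expR _) => *; ring.
have := is_derive_0_is_cst s 0 hd.
have E0 : E 0 = 1 by rewrite /E scale0r expmx0 /cconj map_mx1 mulmx1 WV mxE eqxx.
have a0 : a 0 = 1 by rewrite /a E0.
have b0 : b 0 = 0 by rewrite /b E0.
rewrite /= a0 b0 !mulr0 expR0 !mulr1 addr0 => h.
have : normc (E s) ^+ 2 = expR (s * al) ^+ 2.
  rewrite normc_sqr -/(a s) -/(b s) !expr2.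
  have := expRxMexpNx_1 (2 * al * s); rewrite -mulNr => ee.
  rewrite -[LHS]mulr1 -ee [expR (2 * _ * _) * _]mulrC mulrA h mul1r -expRD; congr expR.
  by move: (al) => ?; ring.
by move=> /eqP; rewrite eqrXn2 ?normc_ge0 ?expR_ge0// => /eqP.
Qed.
End SchurExp.

(** * Triangular recursions *)

(** Once [e] is below [(1 - rho) * d], a window bounded by [b + d] puts the next value below
    [rho * b + d]. The bound on the excess over [d] thus shrinks by [rho] in each block of [n]
    steps. *)
Lemma cvg0_delayed_contraction (R : realType) (u e : nat -> R) (rho : R) (n : nat) :
  0 <= rho < 1 -> (forall k, 0 <= u k) -> e k @[k --> \oo] --> 0 ->
  (forall k b, 0 <= b -> (forall j, (j < n)%N -> u (k + j)%N <= b) ->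
     u (k + n)%N <= rho * b + e k) ->
  u k @[k --> \oo] --> 0.
Proof.
move=> /andP[rho0 rho1] u0 e0 urec.
apply/cvgr0Pnorm_lt => eps eps0.
have rho'0 : 0 < 1 - rho by rewrite subr_gt0.
pose d := eps / 2; have d0 : 0 < d by rewrite divr_gt0.
have [K0 _ eK0] : \forall k \near \oo, `|e k| < (1 - rho) * d.
  by move/cvgr0Pnorm_lt : e0; apply; rewrite mulr_gt0.
pose C := \sum_(j < n) u (K0 + j)%N.
have C0 : 0 <= C by rewrite sumr_ge0.
have step k b : 0 <= b -> (K0 <= k)%N ->
    (forall j, (j < n)%N -> u (k + j)%N <= b + d) -> u (k + n)%N <= rho * b + d.
  move=> b0 Kk ub; have b'0 : 0 <= b + d by rewrite addr_ge0// ltW.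
  apply: (le_trans (urec k _ b'0 ub)).
  have /ltW := le_lt_trans (ler_norm _) (eK0 _ Kk); lra.
have bnd m k : (K0 + m * n <= k)%N -> u k <= rho ^+ m * C + d.
  elim: m k => [|m IHm] k.
    (* The bound [C + d] holds on the initial window, where [C] is the sum of the values, and
       propagates by strong induction since [rho * C <= C]. *)
    rewrite mul0n addn0 expr0 mul1r; elim/ltn_ind: k => k IHk K0k.
    have [kn|nk] := ltnP k (K0 + n).
      have kn' : (k - K0 < n)%N by rewrite ltn_subLR.
      apply: (@le_trans _ _ C); last by rewrite lerDl ltW.
      rewrite /C (bigD1 (Ordinal kn'))//= subnKC// lerDl sumr_ge0//.
    have kE : k = (k - n + n)%N by rewrite subnK// (leq_trans _ nk)// leq_addl.
    rewrite kE; apply: (@le_trans _ _ (rho * C + d)).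
      apply: step => //; first by rewrite leq_subRL ?(leq_trans _ nk) ?leq_addl// addnC.
      move=> j jn; apply: IHk; first by rewrite [ltnRHS]kE ltn_add2l.
      rewrite (leq_trans _ (leq_addr _ _))// leq_subRL ?(leq_trans _ nk) ?leq_addl//.
      by rewrite addnC.
    by rewrite lerD2r ler_piMl// ltW.
  move=> Kk; have nk : (n <= k)%N.
    by rewrite (leq_trans _ Kk)// mulSn addnCA leq_addr.
  rewrite -[k in u k](subnK nk) exprS -mulrA.
  have Kk' : (K0 + m * n <= k - n)%N by rewrite leq_subRL// addnCA -mulSn.
  apply: step; first by rewrite mulr_ge0// exprn_ge0.
    by rewrite (leq_trans _ Kk')// leq_addr.
  by move=> j jn; apply: IHm; rewrite (leq_trans Kk')// leq_addr.
have : (rho ^+ m * C) @[m --> \oo] --> 0.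
  rewrite -[X in _ --> X](mul0r C); apply: cvgMr_tmp.
  by apply: cvg_expr; rewrite ger0_norm.
move=> /cvgr0Pnorm_lt/(_ d d0)[m _ /(_ m (leqnn m)) mC].
exists (K0 + m * n)%N => // k /= /bnd uk; rewrite ger0_norm//.
have := le_lt_trans (ler_norm _) mC.
rewrite /d in uk * => uC; apply: (le_lt_trans uk).
by rewrite [ltRHS](splitr eps) ltrD2r.
Qed.

(** Discrete variation of constants. At [p = n] nilpotency removes the first term, leaving delayed
    terms that all carry a factor [E]. *)
Lemma unroll_recursion (F : comNzRingType) (m n : nat) (M L : 'M[F]_n) (E : 'M[F]_m)
    (Z : nat -> 'M[F]_(n, m)) :
  (forall k, Z k.+1 = M *m Z k + L *m Z k *m E) ->
  forall k p, Z (k + p)%N = M ^+ p *m Z k +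
    \sum_(j < p) M ^+ j *m (L *m Z (k + (p - j.+1))%N *m E).
Proof.
move=> Zrec k; elim=> [|p IHp].
  by rewrite addn0 expr0 mul1mx big_ord0 addr0.
rewrite addnS Zrec {1}IHp mulmxDr mulmxA exprS -mulmxE -addrA; congr (_ + _).
rewrite big_ord_recl expr0 mul1mx subSS subn0 addrC; congr (_ + _).
rewrite mulmx_sumr; apply: eq_bigr => j _.
by rewrite lift0 exprS subSS !mulmxA.
Qed.

Lemma cvg_bigsum0 (K : numFieldType) (T I : Type) (F : set_system T)
    (r : seq I) (P : pred I) (f : I -> T -> K) : Filter F ->
  (forall i, P i -> f i x @[x --> F] --> 0) ->
  \sum_(i <- r | P i) f i x @[x --> F] --> 0.
Proof.
move=> FF f0; rewrite -[X in _ --> X](_ : \sum_(i <- r | P i) (0 : K) = 0).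
  by apply: cvg_big => //; exact: add_continuous.
by rewrite big1.
Qed.

Lemma col_mulmx_tr (F : comNzRingType) (n m p : nat) (X : 'M[F]_(n, m))
    (E : 'M[F]_(p, m)) i :
  col i (X *m E^T) = \sum_l E i l *: col l X.
Proof.
apply/colP => a; rewrite !mxE summxE; apply: eq_bigr => l _.
by rewrite !mxE mulrC.
Qed.

(** Strong induction on the column. With [E] lower triangular, column [i] is driven by itself
    through [E i i], which gives the contraction factor, and by columns [l < i], already known to
    tend to 0, which give the forcing [e]. *)
Lemma triangular_recursion_cvg0 (R : realType) (m n : nat) (M L : 'M[R[i]]_n)
    (E : 'M[R[i]]_m) (Z : nat -> 'M[R[i]]_(n, m)) (a : nat -> R) :
  (forall k, Z k.+1 = M *m Z k + L *m Z k *m E^T) ->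
  M ^+ n = 0 -> is_trig_mx E -> (forall j, 0 <= a j) ->
  (forall j v, norm2C (M ^+ j *m (L *m v)) <= a j * norm2C v) ->
  (forall i, normc (E i i) * \sum_(j < n) a j < 1) ->
  forall i, norm2C (col i (Z k)) @[k --> \oo] --> 0.
Proof.
move=> Zrec Mn /is_trig_mxP Et a0 aP Ea i.
have [p] := ubnP (nat_of_ord i); elim: p i => // p IHp i; rewrite ltnS => ip.
pose u (l : 'I_m) k := norm2C (col l (Z k)).
pose e k := \sum_(j < n) a j * \sum_(l < m | (l < i)%N)
  normc (E i l) * u l (k + (n - j.+1))%N.
apply: (@cvg0_delayed_contraction _ _ e (normc (E i i) * \sum_(j < n) a j) n).
- by rewrite Ea mulr_ge0 ?normc_ge0 ?sumr_ge0.
- by move=> k; exact: norm2C_ge0.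
- apply: cvg_bigsum0 => j _; rewrite -[X in _ --> X](mulr0 (a j)); apply: cvgMl_tmp.
  apply: cvg_bigsum0 => l li.
  rewrite -[X in _ --> X](mulr0 (normc (E i l))); apply: cvgMl_tmp.
  have := IHp l (leq_trans li ip).
  by rewrite -(cvg_shiftn (n - j.+1)%N).
move=> k b b0 ub; rewrite /u (unroll_recursion Zrec) Mn mul0mx add0r.
rewrite linear_sum/=.
apply: (le_trans (norm2C_sum _ _ _)).
rewrite -[normc _ * _ * _]mulrA mulr_suml mulr_sumr -big_split/=; apply: ler_sum => j _.
set Zj := Z _.
have -> : col i (M ^+ j *m (L *m Zj *m E^T)) =
    \sum_l E i l *: (M ^+ j *m (L *m col l Zj)).
  by rewrite !mulmxA col_mulmx_tr; apply: eq_bigr => l _; rewrite -!mulmxA !colE !mulmxA.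
rewrite (bigD1 i)//= (le_trans (norm2CD _ _))// lerD//.
  rewrite norm2CZ ler_wpM2l ?normc_ge0// (le_trans (aP _ _))// ler_wpM2l//.
  by apply: ub; rewrite ltn_subrL/= (leq_trans _ (ltn_ord j)).
apply: (le_trans (norm2C_sum _ _ _)).
rewrite mulr_sumr (bigID (fun l : 'I_m => (l < i)%N))/= [X in _ + X]big1 ?addr0.
  rewrite [leLHS](eq_bigl (fun l : 'I_m => (l < i)%N)).
    by apply: ler_sum => l li; rewrite norm2CZ mulrCA ler_wpM2l ?normc_ge0.
  by move=> l /=; case: eqVneq => [->|]//=; rewrite ltnn.
move=> l /andP[li]; rewrite -leqNgt => il.
by rewrite Et ?scale0r ?norm2C0// ltn_neqAle il andbT eq_sym.
Qed.

(** * Laplacian spectrum *)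

Lemma char_poly_similar (F : idomainType) (n : nat) (P A B : 'M[F]_n) :
  \det P != 0 -> P *m A = B *m P -> char_poly A = char_poly B.
Proof.
move=> P0 PA; have cP : \det (map_mx polyC P) != 0 by rewrite det_map_mx polyC_eq0.
apply: (mulfI cP); rewrite [RHS]mulrC /char_poly -!det_mulmx; congr (\det _).
by rewrite /char_poly_mx mulmxBr mulmxBl -!map_mxM PA scalar_mxC.
Qed.

(** * Quotient of the Laplacian by the constant vectors *)

Section Grounded.
Variables (F : comNzRingType) (m : nat).
Implicit Types G : 'M[F]_(1 + m).

(** Sends [x] to the differences [x_l - x_0]; its kernel is the line of constant vectors. *)
Definition grounding_mx : 'M[F]_(m, 1 + m) := row_mx (- const_mx 1) 1%:M.

(** When [G] kills the constants, this is the map induced on the quotient, in the coordinates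
    [x_l - x_0]. *)
Definition grounded G : 'M[F]_m := drsubmx G - const_mx 1 *m ursubmx G.

Lemma row_sum0_blocks G : G *m const_mx 1 = 0 :> 'cV_(1 + m) ->
  ulsubmx G = - (ursubmx G *m const_mx 1) /\
  dlsubmx G = - (drsubmx G *m const_mx 1).
Proof.
rewrite -[G in G *m _]submxK -[const_mx 1]vsubmxK mul_block_col -[0 in RHS]vsubmxK.
move=> /eq_col_mx[]; rewrite !linear0.
have -> : usubmx (const_mx 1 : 'cV[F]_(1 + m)) = 1%:M.
  by apply/matrixP => i j; rewrite !mxE !ord1 eqxx.
have -> : dsubmx (const_mx 1 : 'cV[F]_(1 + m)) = const_mx 1.
  by apply/matrixP => i j; rewrite !mxE.
by rewrite !mulmx1 => /eqP + /eqP; rewrite !addr_eq0 => /eqP -> /eqP ->.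
Qed.

Lemma grounded_intertwine G : G *m const_mx 1 = 0 :> 'cV_(1 + m) ->
  grounding_mx *m G = grounded G *m grounding_mx.
Proof.
move=> /row_sum0_blocks[Gul Gdl].
rewrite -[G in LHS]submxK mul_row_block Gul Gdl mul_mx_row !mul1mx mulmx1.
congr row_mx; last by rewrite mulNmx addrC.
by rewrite !mulmxN mulNmx opprK mulmxBl opprB mulmxA.
Qed.
End Grounded.

(** In the coordinates given by [x_0] and the differences, a change of determinant 1, [G] is block
    upper triangular with diagonal blocks [0] and [grounded G]. *)
Lemma char_poly_grounded (F : idomainType) (m : nat) (G : 'M[F]_(1 + m)) :
  G *m const_mx 1 = 0 :> 'cV_(1 + m) ->
  char_poly G = 'X * char_poly (grounded G).
Proof.
move=> G0; have [Gul Gdl] := row_sum0_blocks G0.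
pose P : 'M[F]_(1 + m) := col_mx (row_mx 1%:M 0) (grounding_mx F m).
pose B : 'M[F]_(1 + m) := block_mx 0 (ursubmx G) 0 (grounded G).
have detP : \det P = 1 by rewrite /P (@det_lblock _ 1 m) !det1 mulr1.
rewrite (@char_poly_similar F _ P G B) ?detP ?oner_eq0//; last first.
  rewrite /P mul_col_mx (grounded_intertwine G0) /B.
  rewrite [RHS](mul_block_col 0 (ursubmx G) 0 (grounded G)) !mul0mx !add0r.
  congr col_mx.
  rewrite -[G in LHS]submxK mul_row_block !mul1mx !mul0mx !addr0 Gul.
  by rewrite /grounding_mx mul_mx_row mulmx1 mulmxN.
rewrite /char_poly /char_poly_mx /B map_block_mx !map_mx0.
rewrite (@scalar_mx_block _ 1 m) opp_block_mx add_block_mx !oppr0 !addr0 add0r.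
by rewrite det_ublock det_scalar expr1.
Qed.

(** * Maximum principle and real parts of the Laplacian spectrum *)

Section Laplacian.
Variables (R : realType) (q : nat) (gamma : 'M[R]_q).
Hypothesis gamma_ge0 : forall i j, 0 <= gamma i j.
Implicit Types (u x y : 'I_q -> R).

(** At a maximum the terms are nonnegative with nonpositive sum, so each vanishes. *)
Lemma harmonic_in_neighbour u i j :
  (forall k, u k <= u i) -> \sum_k gamma i k * (u i - u k) <= 0 ->
  0 < gamma i j -> u j = u i.
Proof.
move=> ui s0 gij; have t0 k : true -> 0 <= gamma i k * (u i - u k).
  by move=> _; rewrite mulr_ge0// subr_ge0.
have /eqP : \sum_k gamma i k * (u i - u k) = 0.
  by apply/eqP; rewrite eq_le s0 sumr_ge0.
rewrite psumr_eq0// => /allP/(_ j (mem_index_enum _))/=.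
by rewrite mulf_eq0 (gt_eqF gij) subr_eq0 => /eqP.
Qed.

Lemma ex_argmax u : 'I_q -> exists i, forall k, u k <= u i.
Proof.
move=> i0; case: (@arg_maxP _ _ _ i0 xpredT u erefl) => i _ ui.
by exists i => k; exact: ui.
Qed.

(** Maximality spreads from a driven unit to the unit that drives it, so following a path back from
    a maximiser reaches the root. *)
Lemma subharmonic_max_root (T : rel 'I_q) (r : 'I_q) u :
  (forall j i, T j i -> 0 < gamma i j) -> (forall i, connect T r i) ->
  (forall i, \sum_k gamma i k * (u i - u k) <= 0) ->
  forall k, u k <= u r.
Proof.
move=> Tg rT su; have [i ui] := ex_argmax u r.
suff -> : u r = u i by [].
have /connectP[p] := rT i; elim: p r {rT} => [|j p IHp] r /=; first by move=> _ ->.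
move=> /andP[rj jp] ijp; have uj := IHp j jp ijp.
rewrite -uj; apply: (harmonic_in_neighbour (i := j)) => //; last exact: Tg.
by move=> k; rewrite uj.
Qed.

(** At a maximum of [u] the sum is nonnegative, and likewise for [- u], so [c = 0]; then [u] and
    [- u] both peak at the root. Spectrally, [0] is a simple eigenvalue. *)
Lemma laplacian_const (T : rel 'I_q) (r : 'I_q) u (c : R) :
  (forall j i, T j i -> 0 < gamma i j) -> (forall i, connect T r i) ->
  (forall i, \sum_k gamma i k * (u i - u k) = c) ->
  forall i j, u i = u j.
Proof.
move=> Tg rT su.
have sNu i : \sum_k gamma i k * (- u i - - u k) = - c.
  by rewrite -(su i) -sumrN; apply: eq_bigr => k _; ring.
have pos v d : (forall i, \sum_k gamma i k * (v i - v k) = d) -> 0 <= d.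
  move=> sv; have [i vi] := ex_argmax v r.
  by rewrite -(sv i) sumr_ge0// => k _; rewrite mulr_ge0// subr_ge0.
have c0 : c = 0.
  by apply/eqP; rewrite eq_le (pos u)// andbT -oppr_ge0 (pos (fun i => - u i)).
have ur k : u k = u r.
  apply/eqP; rewrite eq_le (subharmonic_max_root Tg rT)//=; last by move=> i; rewrite su c0.
  rewrite -lerN2; apply: (subharmonic_max_root (u := fun i => - u i) Tg rT) => i.
  by rewrite sNu c0 oppr0.
by move=> i j; rewrite !ur.
Qed.

(* x and y are the real and imaginary parts of a vector w such that
   Gamma w = (al + i be) w + (c + i d) 1. *)
Lemma laplacian_mode_Re_gt0 (T : rel 'I_q) (r : 'I_q) x y (al be c d : R) :
  (forall j i, T j i -> 0 < gamma i j) -> (forall i, connect T r i) ->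
  (forall i, \sum_k gamma i k * (x i - x k) = al * x i - be * y i + c) ->
  (forall i, \sum_k gamma i k * (y i - y k) = al * y i + be * x i + d) ->
  0 < al \/ (forall i j, x i = x j /\ y i = y j).
Proof.
move=> Tg rT sx sy; have [al0|al0] := ltP 0 al; [by left | right].
have [ab0|ab0] := eqVneq (al ^+ 2 + be ^+ 2) 0.
  have /andP[/eqP al_0 /eqP be_0] : (al == 0) && (be == 0).
    by rewrite -(@sqrf_eq0 _ al) -(@sqrf_eq0 _ be) -paddr_eq0 ?sqr_ge0// ab0.
  split.
    by apply: (laplacian_const (c := c) Tg rT) => k; rewrite sx al_0 be_0 !mul0r subr0 add0r.
  by apply: (laplacian_const (c := d) Tg rT) => k; rewrite sy al_0 be_0 !mul0r addr0 add0r.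
(* Here [(al + i be) (s + i t) = c + i d], so the shift by [s + i t] absorbs the constant term and
   leaves a pure eigenvalue equation for [W = X + i Y]. *)
pose s := (al * c + be * d) / (al ^+ 2 + be ^+ 2).
pose t := (al * d - be * c) / (al ^+ 2 + be ^+ 2).
pose X i := x i + s; pose Y i := y i + t.
have sX i : \sum_k gamma i k * (X i - X k) = al * X i - be * Y i.
  transitivity (\sum_k gamma i k * (x i - x k)).
    by apply: eq_bigr => k _; rewrite /X; ring.
  by rewrite sx /X /Y /s /t; field.
have sY i : \sum_k gamma i k * (Y i - Y k) = al * Y i + be * X i.
  transitivity (\sum_k gamma i k * (y i - y k)).
    by apply: eq_bigr => k _; rewrite /Y; ring.
  by rewrite sy /X /Y /s /t; field.
(* At a point of largest modulus the real part of each [conj W_i (W_i - W_k)] is nonnegative, while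
   their weighted sum is [al |W_i|^2 <= 0]. *)
have [i max_i] := ex_argmax (fun i => X i ^+ 2 + Y i ^+ 2) r.
have sqd k : X k ^+ 2 + Y k ^+ 2 - 2 * (X k * X i + Y k * Y i) +
    (X i ^+ 2 + Y i ^+ 2) = (X i - X k) ^+ 2 + (Y i - Y k) ^+ 2 by ring.
have t0 k : true -> 0 <= gamma i k * (X i * (X i - X k) + Y i * (Y i - Y k)).
  move=> _; rewrite mulr_ge0//.
  have := max_i k; have := sqd k.
  have := sqr_ge0 (X i - X k); have := sqr_ge0 (Y i - Y k); nra.
have sE : \sum_k gamma i k * (X i * (X i - X k) + Y i * (Y i - Y k)) =
    al * (X i ^+ 2 + Y i ^+ 2).
  transitivity (X i * (\sum_k gamma i k * (X i - X k)) + Y i * (\sum_k gamma i k * (Y i - Y k))).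
    by rewrite !mulr_sumr -big_split; apply: eq_bigr => k _ /=; ring.
  by rewrite sX sY; ring.
have XY0 : 0 <= X i ^+ 2 + Y i ^+ 2 by rewrite addr_ge0 ?sqr_ge0.
have /eqP : \sum_k gamma i k * (X i * (X i - X k) + Y i * (Y i - Y k)) = 0.
  by apply/eqP; rewrite eq_le sumr_ge0// andbT sE mulr_le0_ge0.
rewrite psumr_eq0// => /allP all0.
have term k : gamma i k * (X i - X k) = 0 /\ gamma i k * (Y i - Y k) = 0.
  have /implyP/(_ erefl) := all0 k (mem_index_enum _); rewrite mulf_eq0.
  move=> /orP[/eqP ->|/eqP h]; first by rewrite !mul0r.
  (* Zero real part together with [|W_k| <= |W_i|] forces [W_k = W_i]. *)
  have : (X i - X k) ^+ 2 + (Y i - Y k) ^+ 2 = 0.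
    apply/eqP; rewrite eq_le addr_ge0 ?sqr_ge0// andbT.
    have := max_i k; have := sqd k; nra.
  move=> /eqP; rewrite paddr_eq0 ?sqr_ge0// !sqrf_eq0 => /andP[/eqP -> /eqP ->].
  by rewrite !mulr0.
have eX : al * X i - be * Y i = 0 by rewrite -sX big1// => k _; case: (term k).
have eY : al * Y i + be * X i = 0 by rewrite -sY big1// => k _; case: (term k).
(* The eigenvalue is nonzero, so [W_i = 0]; by maximality [W] vanishes everywhere, and [x] and [y]
   are constant. *)
have : (al ^+ 2 + be ^+ 2) * (X i ^+ 2 + Y i ^+ 2) = 0.
  transitivity ((al * X i - be * Y i) ^+ 2 + (al * Y i + be * X i) ^+ 2); first by ring.
  by rewrite eX eY expr0n addr0.
move=> /eqP; rewrite mulf_eq0 (negPf ab0)/= => /eqP XYi0.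
have XY_0 k : X k = 0 /\ Y k = 0.
  have := max_i k; rewrite XYi0 => h.
  have /andP[] : (X k == 0) && (Y k == 0).
    rewrite -(@sqrf_eq0 _ (X k)) -(@sqrf_eq0 _ (Y k)) -paddr_eq0 ?sqr_ge0// eq_le h.
    by rewrite addr_ge0 ?sqr_ge0.
  by move=> /eqP -> /eqP ->.
move=> j k; have [Xj Yj] := XY_0 j; have [Xk Yk] := XY_0 k.
by split; [apply: (addIr s) | apply: (addIr t)]; rewrite -/(X _) -/(Y _) ?Xj ?Yj.
Qed.
End Laplacian.

Lemma laplacian_mulE (R : realType) (q : nat) (gamma : 'M[R]_q) (u : 'cV[R]_q) i :
  (forall i, gamma i i = 0) ->
  (laplacian gamma *m u) i 0 = \sum_k gamma i k * (u i 0 - u k 0).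
Proof.
move=> g0; rewrite mxE (bigD1 i)//= mxE eqxx.
rewrite [in RHS](eq_bigr (fun k => gamma i k * u i 0 - gamma i k * u k 0)); last first.
  by move=> k _; rewrite mulrBr.
rewrite sumrB -mulr_suml; congr (_ + _).
rewrite [in RHS](bigD1 i)//= g0 mul0r add0r -sumrN; apply: eq_bigr => k ki.
by rewrite mxE eq_sym (negPf ki) mulNr.
Qed.

Lemma laplacian_const1 (R : realType) (q : nat) (gamma : 'M[R]_q) :
  (forall i, gamma i i = 0) -> laplacian gamma *m const_mx 1 = 0 :> 'cV_q.
Proof.
move=> g0; apply/colP => i; rewrite laplacian_mulE// big1 ?mxE// => k _.
by rewrite !mxE subrr mulr0.
Qed.

(** Padding with a zero first coordinate is a section of the quotient, so [G] and [grounded G] agree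
    on it up to a constant vector, which becomes the term [c + i d] of the mode equation. *)
Lemma grounded_lift (F : comNzRingType) (m : nat) (G : 'M[F]_(1 + m)) (v : 'cV[F]_m) :
  G *m col_mx 0 v = col_mx 0 (grounded G *m v) +
    (ursubmx G *m v) 0 0 *: const_mx 1.
Proof.
rewrite -[G in LHS]submxK mul_block_col !mulmx0 !add0r -(@col_mx_const _ 1 m).
rewrite scale_col_mx add_col_mx add0r; congr col_mx.
  by apply/matrixP => i j; rewrite !ord1 !mxE mulr1.
rewrite /grounded mulmxBl -mulmxA [X in const_mx 1 *m X]mx11_scalar.
by rewrite mul_mx_scalar subrK.
Qed.

(** An eigenvector of the quotient, padded with 0, satisfies the equations of
    [laplacian_mode_Re_gt0]. Were it constant, its zero first entry would make it vanish. *)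
Lemma grounded_laplacian_Re_gt0 (R : realType) (m : nat) (gamma : 'M[R]_(1 + m)) (z : R[i]) :
  (forall i j, 0 <= gamma i j) -> (forall i, gamma i i = 0) ->
  has_spanning_tree (network_edge gamma) ->
  root (char_poly (map_mx (real_complex R) (grounded (laplacian gamma)))) z ->
  0 < complex.Re z.
Proof.
move=> g_ge0 g0 [T [r [Tg _ _ rT]]].
set G := laplacian gamma; set A := map_mx _ _.
rewrite -eigenvalue_root_char => /eigenvalueP[w Aw w0].
(* [eigenvalue] concerns row vectors; transposing the determinant yields a column eigenvector. *)
have : \det (z%:M - A)^T == 0.
  by rewrite det_tr; apply/det0P; exists w; rewrite // mulmxBr Aw mul_mx_scalar subrr.
case/det0P => v' v'0 /(congr1 trmx); rewrite trmx0 trmx_mul trmxK.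
set v := v'^T; have v0 : v != 0 by rewrite /v -trmx0 (inj_eq trmx_inj).
rewrite mulmxBl mul_scalar_mx => /eqP; rewrite subr_eq0 => /eqP Av.
pose x := map_mx (@complex.Re R) v; pose y := map_mx (@complex.Im R) v.
have Ax : grounded G *m x = complex.Re z *: x - complex.Im z *: y.
  rewrite -map_Re_mulmx -Av; apply/colP => i; rewrite !mxE; exact: Re_mulc.
have Ay : grounded G *m y = complex.Re z *: y + complex.Im z *: x.
  rewrite -map_Im_mulmx -Av; apply/colP => i; rewrite !mxE; exact: Im_mulc.
have [] := @laplacian_mode_Re_gt0 R _ gamma g_ge0 T r
  (fun i => (col_mx 0 x : 'cV_(1 + m)) i 0)
  (fun i => (col_mx 0 y : 'cV_(1 + m)) i 0) (complex.Re z) (complex.Im z)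
  ((ursubmx G *m x) 0 0) ((ursubmx G *m y) 0 0) Tg rT.
- move=> i; rewrite -laplacian_mulE// grounded_lift Ax !mxE mulr1.
  by case: (fintype.split i) => j; rewrite !mxE ?mulr0 ?subr0.
- move=> i; rewrite -laplacian_mulE// grounded_lift Ay !mxE mulr1.
  by case: (fintype.split i) => j; rewrite !mxE ?mulr0 ?addr0.
- by [].
move=> xy; case/eqP: v0; apply/colP => i.
have [] := xy (rshift 1 i) (lshift m 0); rewrite !col_mxEu !col_mxEd !mxE.
by case: (v' 0 i) => a b /= -> ->.
Qed.

(** Sorting puts 0, the only element of [0 :: s] without positive real part, in front, so index 1
    holds the least real part of [s]; as [s] is nonempty, this is not the default value of [nth]. *)
Lemma sorted_spectrum (R : realType) (s t : seq R[i]) :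
  'X * \prod_(z <- s) ('X - z%:P) = \prod_(z <- t) ('X - z%:P) ->
  (0 < size s)%N -> (forall z, z \in s -> 0 < complex.Re z) ->
  sorted (fun z w : R[i] => complex.Re z <= complex.Re w) t ->
  0 < complex.Re t`_1 /\ (forall z, z \in s -> complex.Re t`_1 <= complex.Re z).
Proof.
move=> st s0 sRe; have {st} : perm_eq (0 :: s) t.
  by apply: prod_XsubC_eq; rewrite big_cons subr0.
have tr : transitive (fun z w : R[i] => complex.Re z <= complex.Re w).
  by move=> a b c; exact: le_trans.
case: t => [/perm_size//|t0 t st /[dup] tsort /= /(order_path_min tr)/allP t0min].
have t00 : t0 = 0.
  have : t0 \in 0 :: s by rewrite (perm_mem st) mem_head.
  rewrite inE => /orP[/eqP //|/sRe]; rewrite ltNge.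
  have : 0 \in t0 :: t by rewrite -(perm_mem st) mem_head.
  by rewrite inE => /orP[/eqP <-|/t0min ->]; rewrite ?lexx.
move: st; rewrite t00 perm_cons => st.
case: t st tsort {t0min} => [/perm_size s_eq0|t1 t st /= /andP[_ /(order_path_min tr)/allP t1min]].
  by rewrite s_eq0 in s0.
split; first by apply: sRe; rewrite (perm_mem st) mem_head.
by move=> z; rewrite (perm_mem st) inE => /orP[/eqP ->|/t1min].
Qed.

(** * Sampled dynamics *)

Lemma map_mx_expr (F F' : nzRingType) (f : {rmorphism F -> F'}) (n : nat) (A : 'M[F]_n) k :
  map_mx f (A ^+ k) = map_mx f A ^+ k.
Proof.
elim: k => [|k IHk]; first by rewrite !expr0 map_mx1.
by rewrite !exprS -IHk -!mulmxE map_mxM.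
Qed.

Lemma norm2C_expr_le (R : realType) (n : nat) (M : 'M[R[i]]_n) k v :
  norm2C (M ^+ k *m v) <= opnorm2C M ^+ k * norm2C v.
Proof.
elim: k => [|k IHk]; first by rewrite !expr0 mul1mx mul1r.
rewrite !exprS -mulmxE -mulmxA (le_trans (norm2C_mulmx_le _ _))// -mulrA.
by rewrite ler_wpM2l// opnorm2C_ge0.
Qed.

(** An isometry conjugates powers of [M] to powers of [N]; this brings in the terms of the sum that
    bounds [mu]. *)
Lemma norm2C_unitary_conj_expr_le (R : realType) (n : nat) (M Q : 'M[R[i]]_n) k v :
  Q \is unitarymx ->
  norm2C (M ^+ k *m v) <= opnorm2C ((Q ^t*)%sesqui *m M *m Q) ^+ k * norm2C v.
Proof.
move=> QU; set N := _ *m Q.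
have QQ : Q *m (Q ^t*)%sesqui = 1%:M by exact/unitarymxP.
have MQ j : M ^+ j *m Q = Q *m N ^+ j.
  elim: j => [|j IHj]; first by rewrite !expr0 mul1mx mulmx1.
  rewrite exprS -mulmxE -mulmxA IHj exprS -mulmxE /N !mulmxA QQ mul1mx.
  by rewrite -!mulmxA.
have -> : M ^+ k *m v = Q *m (N ^+ k *m ((Q ^t*)%sesqui *m v)).
  by rewrite mulmxA -MQ -!mulmxA (mulmxA Q) QQ mul1mx.
have QtU : (Q ^t*)%sesqui \is unitarymx by rewrite trmxC_unitary.
by rewrite (norm2C_unitary _ QU) -(norm2C_unitary v QtU); exact: norm2C_expr_le.
Qed.

Lemma normc_real (R : realType) (a : R) : normc (real_complex R a) = `|a|.
Proof. by rewrite /= expr0n addr0 sqrtr_sqr. Qed.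

Lemma discrete_synchronization (R : realType) (m n : nat) (M L : 'M[R]_n)
    (gamma : 'M[R]_(1 + m)) (mu : R) (lambda : seq R[i]) (Q : 'M[R[i]]_n)
    (X : nat -> 'M[R]_(n, 1 + m)) :
  (0 < m)%N -> 0 < mu ->
  (forall i j, 0 <= gamma i j) -> (forall i, gamma i i = 0) ->
  has_spanning_tree (network_edge gamma) ->
  M ^+ n = 0 ->
  char_poly (map_mx (real_complex R) (laplacian gamma)) = \prod_(z <- lambda) ('X - z%:P) ->
  sorted (fun z w : R[i] => complex.Re z <= complex.Re w) lambda ->
  Q \is unitarymx ->
  (complex.Re lambda`_1)^-1 * ln (opnorm2 L * \sum_(0 <= k < n)
    opnorm2C ((Q ^t*)%sesqui *m map_mx (real_complex R) M *m Q) ^+ k) < mu ->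
  (forall k, X k.+1 = M *m X k + L *m X k *m (expmx (- mu *: laplacian gamma))^T) ->
  forall a i, (X k *m (grounding_mx R m)^T) a i @[k --> \oo] --> 0.
Proof.
move=> m0 mu0 g_ge0 g0 tree Mn lamE lam_sort QU bound Xrec a i.
set G := laplacian gamma; set G' := grounded G.
have G1 : G *m const_mx 1 = 0 :> 'cV_(1 + m) by exact: laplacian_const1.
pose D := grounding_mx R m; pose Y k := X k *m D^T.
have DE : D *m expmx (- mu *: G) = expmx (- mu *: G') *m D.
  by apply: expmx_intertwine; rewrite -scalemxAr -scalemxAl grounded_intertwine.
have Yrec k : Y k.+1 = M *m Y k + L *m Y k *m (expmx (- mu *: G'))^T.
  by rewrite /Y Xrec mulmxDl -!mulmxA -!trmx_mul DE.
pose A := map_mx (real_complex R) G'.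
have [W WU] := Schur A m0; rewrite /similar_to/= conjymx// => Utrig.
set V := (W ^t*)%sesqui in Utrig.
have WV : W *m V = 1%:M by exact/unitarymxP.
have VW : V *m W = 1%:M by exact: mulmx1C.
pose U := cconj W V G'.
(* The diagonal of the triangular [U] lists the eigenvalues of the quotient, in no particular
   order. *)
have charU : char_poly A = \prod_(z <- [seq U l l | l : 'I_m]) ('X - z%:P).
  rewrite big_image/= -(char_poly_trig Utrig).
  apply: (@char_poly_similar _ _ W); last by rewrite /U /cconj -!mulmxA VW mulmx1.
  by rewrite -unitfE -[_ \is a _]/(W \in unitmx) unitarymx_unit.
have [lam1 lamU] : 0 < complex.Re lambda`_1 /\
    (forall z, z \in [seq U l l | l : 'I_m] -> complex.Re lambda`_1 <= complex.Re z).
  apply: sorted_spectrum lam_sort.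
  - rewrite -lamE -charU (char_poly_grounded (G := map_mx _ G)); last first.
      by rewrite -(map_const_mx (real_complex R)) -map_mxM G1 map_mx0.
    rewrite /grounded -map_drsubmx -map_ursubmx -(map_const_mx (real_complex R)).
    by rewrite -map_mxM -map_mxB.
  - by rewrite size_map -cardE card_ord.
  - move=> z zU; apply: (grounded_laplacian_Re_gt0 g_ge0 g0 tree).
    by rewrite -/A charU root_prod_XsubC.
pose E := cconj W V (expmx (- mu *: G')).
pose c := opnorm2 L * \sum_(0 <= k < n)
    opnorm2C ((Q ^t*)%sesqui *m map_mx (real_complex R) M *m Q) ^+ k.
(* Units are columns, so a change of basis among them acts on the right, through the transpose
   [W^T]. *)
pose Z k := map_mx (real_complex R) (Y k) *m W^T.
have Z0 l : norm2C (col l (Z k)) @[k --> \oo] --> 0.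
  apply: (@triangular_recursion_cvg0 _ _ _ (map_mx (real_complex R) M)
    (map_mx (real_complex R) L) E Z
    (fun j => opnorm2C ((Q ^t*)%sesqui *m map_mx (real_complex R) M *m Q) ^+ j * opnorm2 L)).
  - move=> k; rewrite /Z Yrec; move: (Y k) => Yk.
    rewrite map_mxD mulmxDl !map_mxM -!mulmxA; congr (_ + _ *m (_ *m _)).
    rewrite -map_trmx -!trmx_mul; congr (_^T).
    by rewrite /E /cconj -!mulmxA VW mulmx1.
  - by rewrite -map_mx_expr Mn map_mx0.
  - exact: cconj_expmx_trig.
  - by move=> j; rewrite mulr_ge0 ?opnorm2_ge0// exprn_ge0// opnorm2C_ge0.
  - move=> j v; apply: (le_trans (norm2C_unitary_conj_expr_le _ _ _ QU)).
    by rewrite -mulrA ler_wpM2l ?exprn_ge0 ?opnorm2C_ge0// norm2C_map_mulmx_le.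
  - move=> p; rewrite (normc_cconj_expmx WU Utrig) -mulr_suml mulrC.
    rewrite [X in X * _]mulrC -(big_mkord xpredT (fun j => opnorm2C _ ^+ j)) -/c.
    (* [ln] has a default value off the positive reals, so [c <= 0] is set apart; there the product
       is at most 0. Otherwise one compares [ln c] with [mu] times the real part of [U p p]. *)
    have [c0|c0] := leP c 0.
      by rewrite (le_lt_trans _ ltr01)// mulr_le0_ge0// expR_ge0.
    rewrite mulNr expRN ltr_pdivrMr ?expR_gt0// mul1r -ltr_ln ?posrE ?expR_gt0// expRK.
    rewrite (@lt_le_trans _ _ (mu * complex.Re lambda`_1))//.
      by move: bound; rewrite mulrC ltr_pdivrMr.
    by rewrite ler_wpM2l ?(ltW mu0)//; apply: lamU; exact: fintype.image_f.
have YE k : map_mx (real_complex R) (Y k) = Z k *m V^T.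
  by rewrite /Z -mulmxA -trmx_mul VW trmx1 mulmx1.
have Yle k : `|Y k a i| <= \sum_l norm2C (col l (Z k)) * normc (V i l).
  rewrite -normc_real.
  have -> : real_complex R (Y k a i) = (Z k *m V^T) a i by rewrite -YE [RHS]mxE.
  rewrite mxE (le_trans (normc_sum _ _))//; apply: ler_sum => l _.
  rewrite Normc.normcM [V^T l i]mxE ler_wpM2r ?normc_ge0//.
  by have := normc_coord_le (col l (Z k)) a; rewrite [col _ _ _ _]mxE.
apply/norm_cvg0P; apply: (squeeze_cvgr (f := fun=> 0)
  (h := fun k => \sum_l norm2C (col l (Z k)) * normc (V i l))).
- by near=> k; rewrite normr_ge0 Yle.
- exact: cvg_cst.
apply: cvg_bigsum0 => l _.
by rewrite -[X in _ --> X](mul0r (normc (V i l))); apply: cvgMr_tmp.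
Unshelve. all: by end_near. Qed.

(** * Kronecker products and the flow *)

Lemma det_expr (F : comNzRingType) (n : nat) (A : 'M[F]_n) k :
  \det (A ^+ k) = \det A ^+ k.
Proof.
elim: k => [|k IHk]; first by rewrite !expr0 det1.
by rewrite !exprS -mulmxE det_mulmx IHk.
Qed.

(* A row in the left kernel of 1 - B K is a multiple of K, which K B then fixes. *)
Lemma nilpotent_closed_loop_gain (F : fieldType) (n : nat) (B : 'cV[F]_n)
    (K : 'rV[F]_n) (S : 'M[F]_n) :
  (0 < n)%N -> S \in unitmx -> ((1%:M - B *m K) *m S) ^+ n = 0 -> K *m B = 1%:M.
Proof.
(* Nilpotency gives a zero determinant and [S] is invertible, so [1 - B K] is singular. *)
case: n B K S => // n B K S _ Su /(congr1 determinant); rewrite det_expr det_mulmx.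
have S0 : \det S != 0 by rewrite -unitfE -unitmxE.
move/eqP; rewrite det0 expf_eq0 mulf_eq0/= (negPf S0) orbF.
case/det0P => v v0; rewrite mulmxBr mulmx1 mulmxA [v *m B]mx11_scalar mul_scalar_mx.
set s := (v *m B) 0 0 => /eqP; rewrite subr_eq0 => /eqP vE.
have s0 : s != 0 by apply: contraNneq v0 => s0; rewrite vE s0 scale0r.
have : s *: (K *m B) = s%:M by rewrite scalemxAl -vE [LHS]mx11_scalar.
by move=> /(congr1 ( *:%R s^-1)); rewrite scalerA mulVf// scale1r scale_scalar_mx mulVf.
Qed.

Section Tensor.
Variables (R : realType) (q n : nat).
Implicit Types (G : 'M[R]_q) (P A : 'M[R]_n).

Lemma tens_mx11 : (1%:M : 'M[R]_q) *t (1%:M : 'M[R]_n) = 1%:M.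
Proof.
apply/matrixP => i j.
case: (mxtens_indexP i) => i1 i2; case: (mxtens_indexP j) => j1 j2.
rewrite tensmxE !mxE (can_eq (@mxtens_indexK q n)) xpair_eqE.
by case: (i1 == j1); case: (i2 == j2); rewrite ?mulr1 ?mulr0 ?mul0r.
Qed.

Lemma tens1mx_expr A k : (1%:M *t A : 'M[R]_(q * n)) ^+ k = 1%:M *t A ^+ k.
Proof.
elim: k => [|k IHk]; first by rewrite !expr0 tens_mx11.
by rewrite !exprS IHk -!mulmxE tensmx_mul mulmx1.
Qed.

Lemma tensmx1_expr G k : (G *t 1%:M : 'M[R]_(q * n)) ^+ k = G ^+ k *t 1%:M.
Proof.
elim: k => [|k IHk]; first by rewrite !expr0 tens_mx11.
by rewrite !exprS IHk -!mulmxE tensmx_mul mulmx1.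
Qed.

Lemma expmx_tens1mx A : expmx (1%:M *t A : 'M[R]_(q * n)) = 1%:M *t expmx A.
Proof.
apply/matrixP => i j.
case: (mxtens_indexP i) => i1 i2; case: (mxtens_indexP j) => j1 j2.
rewrite tensmxE.
have l2 := @cvgMl_tmp _ _ _ _ _ ((1%:M : 'M[R]_q) i1 j1) _ (@cvg_expmx_coord R n A i2 j2).
apply: (cvg_unique _ (@cvg_expmx_coord _ _ _ _ _)) => //.
rewrite [X in X @ _](_ : _ = fun k => (1%:M : 'M[R]_q) i1 j1 *
  series (fun k => (k`!%:R)^-1 * (A ^+ k) i2 j2) k); first exact: l2.
apply/funext => k; rewrite /series/= mulr_sumr; apply: eq_bigr => l _.
by rewrite tens1mx_expr tensmxE mulrCA.
Qed.

Lemma expmx_tensmx1 G : expmx (G *t 1%:M : 'M[R]_(q * n)) = expmx G *t 1%:M.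
Proof.
apply/matrixP => i j.
case: (mxtens_indexP i) => i1 i2; case: (mxtens_indexP j) => j1 j2.
rewrite tensmxE.
have l2 := @cvgMr_tmp _ _ _ _ _ _ ((1%:M : 'M[R]_n) i2 j2) (@cvg_expmx_coord R q G i1 j1).
apply: (cvg_unique _ (@cvg_expmx_coord _ _ _ _ _)) => //.
rewrite [X in X @ _](_ : _ = fun k =>
  series (fun k => (k`!%:R)^-1 * (G ^+ k) i1 j1) k * (1%:M : 'M[R]_n) i2 j2); first exact: l2.
apply/funext => k; rewrite /series/= mulr_suml; apply: eq_bigr => l _.
by rewrite tensmx1_expr tensmxE mulrA.
Qed.

(* 1 (x) P intertwines G (x) P with G (x) 1, and 1 (x) (1 - P) intertwines it
   with 0. *)
Lemma expmx_tens_idem G P : P *m P = P ->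
  expmx (G *t P) = 1%:M *t (1%:M - P) + expmx G *t P.
Proof.
move=> PP.
have E1 : (1%:M *t P) *m expmx (G *t P) = expmx G *t P.
  rewrite (@expmx_intertwine _ _ _ _ _ (G *t 1%:M)).
    by rewrite expmx_tensmx1 tensmx_mul mulmx1 mul1mx.
  by rewrite !tensmx_mul PP !mul1mx mulmx1.
have E2 : (1%:M *t (1%:M - P)) *m expmx (G *t P) = 1%:M *t (1%:M - P).
  rewrite (@expmx_intertwine _ _ _ _ _ 0) ?expmx0 ?mul1mx//.
  by rewrite tensmx_mul mulmxBl PP !mul1mx subrr tensmx0 mul0mx.
rewrite -E1 -[in RHS]E2 -mulmxDl -[LHS]mul1mx; congr (_ *m _).
rewrite -tens_mx11; apply/matrixP => i j.
case: (mxtens_indexP i) => i1 i2; case: (mxtens_indexP j) => j1 j2.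
by rewrite [RHS]mxE !tensmxE -mulrDr; congr (_ * _); rewrite !mxE subrK.
Qed.

(** Undoes vectorisation, one column per unit: a Kronecker product then acts by multiplication on
    both sides. *)
Definition state_mx (x : 'cV[R]_(q * n)) : 'M[R]_(n, q) :=
  \matrix_(a, i) x (mxtens_index (i, a)) 0.

Lemma state_mx_tens G A x : state_mx (G *t A *m x) = A *m state_mx x *m G^T.
Proof.
apply/matrixP => a i; rewrite !mxE.
under [RHS]eq_bigr do rewrite !mxE mulr_suml.
rewrite pair_big (reindex (@mxtens_index q n))/=; last first.
  by exists (@mxtens_unindex q n) => ? _; [exact: mxtens_indexK | exact: mxtens_unindexK].
by apply: eq_bigr => -[j b] _; rewrite tensmxE !mxE /=; ring.
Qed.

Lemma col_state_mx x i : col i (state_mx x) = unit_state x i.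
Proof. by apply/colP => a; rewrite !mxE. Qed.
End Tensor.

Lemma normr_expmx_le (R : realType) (n : nat) (M : 'M[R]_n) i j :
  `|expmx M i j| <= expR (mx_l1 M).
Proof.
apply: (ler_cvg_to (cvg_norm (@cvg_expmx_coord R n M i j)) (is_cvg_series_exp_coeff (mx_l1 M))).
near=> k; rewrite /series/= (le_trans (ler_norm_sum _ _ _))// ler_sum// => l _.
rewrite normrM mulrC [`|_^-1|]ger0_norm ?invr_ge0//.
by rewrite ler_wpM2r ?invr_ge0//; exact: normr_expr_mx_le.
Unshelve. all: by end_near. Qed.

Lemma mx_l1Z (R : realType) (n : nat) (a : R) (M : 'M[R]_n) :
  mx_l1 (a *: M) = `|a| * mx_l1 M.
Proof.
rewrite /mx_l1 mulr_sumr; apply: eq_bigr => i _; rewrite mulr_sumr.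
by apply: eq_bigr => j _; rewrite mxE normrM.
Qed.

Lemma grounding_diff_cvg0 (R : realType) (m n : nat) (X : nat -> 'M[R]_(n, 1 + m)) :
  (forall a l, (X k *m (grounding_mx R m)^T) a l @[k --> \oo] --> 0) ->
  forall a i j, X k a i - X k a j @[k --> \oo] --> 0.
Proof.
move=> X0 a.
have XE k l : (X k *m (grounding_mx R m)^T) a l = X k a (rshift 1 l) - X k a ord0.
  rewrite /grounding_mx tr_row_mx -[X in X *m _]hsubmxK mul_row_col trmx1 mulmx1.
  rewrite 2!mxE big_ord1 !mxE mulrN1 addrC; congr (_ - X k a _).
  by apply: val_inj.
have D0 i : X k a i - X k a ord0 @[k --> \oo] --> 0.
  rewrite -(splitK i); case: (fintype.split i) => l /=.
    rewrite (_ : lshift m l = ord0); last by apply: val_inj; rewrite /= ord1.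
    by under eq_fun do rewrite subrr; exact: cvg_cst.
  by under eq_fun do rewrite -XE; exact: X0.
move=> i j; rewrite -[X in _ --> X](subrr 0).
rewrite [X in X @ _](_ : _ =
  fun k => (X k a i - X k a ord0) - (X k a j - X k a ord0)); last first.
  by apply/funext => k; rewrite opprB addrA subrK.
exact: cvgB.
Qed.

(** * Trajectories between and across impulses *)

Section Flow.
Variables (R : realType) (q n : nat) (A : 'M[R]_n) (B : 'M[R]_(n, 1)).
Variables (K : 'M[R]_(1, n)) (T mu : R) (gamma : 'M[R]_q).
Variables (x0 : 'cV[R]_(q * n)) (x : R -> 'cV[R]_(q * n)).
Hypotheses (T_gt0 : 0 < T) (xsol : network_solution A B K T mu gamma x0 x).
Let F : 'M[R]_(q * n) := 1%:M *t A.
Let J : 'M[R]_(q * n) := expmx (- mu *: (laplacian gamma *t (B *m K))).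

(** At an impulse this is part of the notion of solution; at time 0 it follows from the one-sided
    derivative, as [x h] is [x 0] plus [h] times the difference quotient. *)
Lemma network_right_continuous k :
  x t @[t --> (k%:R * T)^'+] --> x (k%:R * T).
Proof.
have [_ d0 _ jump] := xsol; case: k => [|k]; last first.
  by have [xm [_ + ->]] := jump k.+1 isT.
rewrite mul0r -[X in _ --> X](addr0 (x 0)) -(scale0r (F *m x 0)).
have l : h *: (h^-1 *: (x h - x 0)) @[h --> 0^'+] --> (0 : R) *: (F *m x 0).
  apply: cvgZ; last exact: d0.
  by apply: cvg_at_right_filter; exact: cvg_id.
have : x 0 + h *: (h^-1 *: (x h - x 0)) @[h --> 0^'+] --> x 0 + (0 : R) *: (F *m x 0).
  by apply: cvgD; [exact: cvg_cst | exact: l].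
apply: cvg_trans; apply: near_eq_cvg; near=> h.
have h0 : h != 0 by rewrite gt_eqF//; near: h; exact: nbhs_right_gt.
by rewrite scalerA mulfV// scale1r subrKC.
Unshelve. all: by end_near. Qed.

Lemma network_flow_open k t : k%:R * T < t < k.+1%:R * T ->
  x t = expmx ((t - k%:R * T) *: F) *m x (k%:R * T).
Proof.
have [_ _ xd _] := xsol.
apply: linear_ode_solution; first exact: network_right_continuous.
move=> s /andP[ks sk]; apply: xd.
  by rewrite (le_lt_trans _ ks)// mulr_ge0// ltW.
move=> j _; apply/eqP => sE; move: ks sk; rewrite sE !ltr_pM2r// !ltr_nat ltnS.
by move=> /leq_trans h /h; rewrite ltnn.
Qed.

Lemma network_flow k t : k%:R * T <= t < k.+1%:R * T ->
  x t = expmx ((t - k%:R * T) *: F) *m x (k%:R * T).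
Proof.
rewrite le_eqVlt => /andP[/orP[/eqP <- _|kt tk]].
  by rewrite subrr scale0r expmx0 mul1mx.
by apply: network_flow_open; rewrite kt.
Qed.

(** The left limit [xm] before the jump is computed from the flow on the open interval, limits being
    unique. *)
Lemma network_step k :
  x (k.+1%:R * T) = J *m (expmx (T *: F) *m x (k%:R * T)).
Proof.
have [_ _ _ jump] := xsol; have [xm [xl _ ->]] := jump k.+1 isT.
congr (_ *m _); apply/colP => i.
have l1 : x t i 0 @[t --> (k.+1%:R * T)^'-] --> xm i 0.
  exact: (@cvg_mx_coord _ _ _ _ _ x xm i 0 _ xl).
have TE : k.+1%:R * T - k%:R * T = T by rewrite -mulrBl -natrB// subSnn mul1r.
have l2 (G : 'M[R]_(q * n)) (y : 'cV[R]_(q * n)) :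
    (expmx ((t - k%:R * T) *: G) *m y) i 0
    @[t --> (k.+1%:R * T)^'-] --> (expmx (T *: G) *m y) i 0.
  have : (expmx ((t - k%:R * T) *: G) *m y) i 0 @[t --> (k.+1%:R * T)^'-] -->
      (expmx ((k.+1%:R * T - k%:R * T) *: G) *m y) i 0.
    rewrite [X in _ --> X]mxE; under eq_fun do rewrite mxE.
    apply: cvg_bigsum => l; apply: cvgMr_tmp; apply: cvg_at_left_filter.
    exact: expmx_shift_continuous.
  by rewrite TE.
have l3 : x t i 0 @[t --> (k.+1%:R * T)^'-] -->
    (expmx (T *: F) *m x (k%:R * T)) i 0.
  apply: cvg_trans (l2 F (x (k%:R * T))); apply: near_eq_cvg; near=> t.
  rewrite (@network_flow_open k t)//; apply/andP.
  split; last by near: t; exact: nbhs_left_lt.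
  by near: t; apply: nbhs_left_gt; rewrite ltr_pM2r// ltr_nat.
exact: (cvg_unique _ l1 l3).
Unshelve. all: by end_near. Qed.

Lemma network_state_step k : K *m B = 1%:M ->
  let S := expmx (T *: A) in
  state_mx (x (k.+1%:R * T)) =
    (1%:M - B *m K) *m S *m state_mx (x (k%:R * T)) +
    B *m K *m S *m state_mx (x (k%:R * T)) *m (expmx (- mu *: laplacian gamma))^T.
Proof.
move=> KB S; rewrite network_step /F /J.
have tensZl (a : R) (G : 'M[R]_q) (P : 'M[R]_n) : a *: (G *t P) = (a *: G) *t P.
  by apply/matrixP => i j; rewrite !mxE mulrA.
have tensZr (a : R) (G : 'M[R]_q) (P : 'M[R]_n) : a *: (G *t P) = G *t (a *: P).
  by apply/matrixP => i j; rewrite !mxE mulrCA.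
rewrite (tensZl (- mu)) (tensZr T) expmx_tens1mx expmx_tens_idem; last first.
  (* [B K] is idempotent because [B (K B) K = B K]. *)
  by rewrite mulmxA -[B *m K *m B]mulmxA KB mulmx1.
rewrite [in LHS]mulmxDl ![in LHS]mulmxA !tensmx_mul mul1mx mulmx1.
have -> y z : state_mx (y + z) = state_mx y + state_mx z :> 'M[R]_(n, q).
  by apply/matrixP => a i; rewrite !mxE.
by rewrite !state_mx_tens trmx1 mulmx1.
Qed.

(** Every unit is moved by the same [e^(sA)] with [0 <= s <= T], hence so are the differences; the
    exponential bounds its entries, and [n] counts the rows. *)
Lemma unit_diff_bound k t i j : k%:R * T <= t < k.+1%:R * T ->
  norm2 (unit_state (x t) i - unit_state (x t) j) <=
  (n%:R * expR (T * mx_l1 A)) *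
    \sum_b `|state_mx (x (k%:R * T)) b i - state_mx (x (k%:R * T)) b j|.
Proof.
move=> /[dup] /andP[kt tk] /network_flow ->.
set s := t - _; set y := x _; set C := expR _.
have s0 : 0 <= s by rewrite subr_ge0.
have sT : s <= T by rewrite lerBlDr ltW// (lt_le_trans tk)// mulrSr mulrDl mul1r addrC.
have tensZr : s *: F = 1%:M *t (s *: A).
  by apply/matrixP => a b; rewrite !mxE mulrCA.
rewrite tensZr expmx_tens1mx -!col_state_mx state_mx_tens trmx1 mulmx1.
rewrite (le_trans (norm2_le_sum _))// -mulrA.
rewrite (_ : n%:R * _ = \sum_(a < n) C * \sum_b `|state_mx y b i - state_mx y b j|);
  last by rewrite sumr_const card_ord mulr_natl.
apply: ler_sum => a _; rewrite !mxE -sumrB mulr_sumr (le_trans (ler_norm_sum _ _ _))//.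
apply: ler_sum => b _; rewrite -mulrBr normrM ler_wpM2r// (le_trans (normr_expmx_le _ _ _))//.
by rewrite ler_expR mx_l1Z ger0_norm// ler_wpM2r// mx_l1_ge0.
Qed.
End Flow.

(* Synchronization in continuous time *)
Local Close Scope classical_set_scope.

Theorem theorem1 (R : realType) (q n : nat) (hq : (2 <= q)%N)
    (A : 'M[R]_n) (B : 'M[R]_(n, 1)) (K : 'M[R]_(1, n)) (T mu : R)
    (gamma : 'M[R]_q) (lambda : seq R[i]) (Q N : 'M[R[i]]_n)
    (hT : 0 < T) (hmu : 0 < mu)
    (hgamma : forall i j : 'I_q, 0 <= gamma i j)
    (hgamma_diag : forall i : 'I_q, gamma i i = 0)
    (hAB : controllable A B)
    (hATB : controllable (expmx (T *: A)) B)
    (htree : has_spanning_tree (network_edge gamma))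
    (hnil : ((1%:M - B *m K) *m expmx (T *: A)) ^+ n = 0)
    (heig : char_poly (map_mx (real_complex R) (laplacian gamma)) =
              \prod_(z <- lambda) ('X - z%:P))
    (hsort : sorted (fun z w : R[i] => complex.Re z <= complex.Re w) lambda)
    (hN : strictly_upper_triangular N)
    (hQ : Q \is unitarymx)
    (hQN : (Q ^t*)%sesqui *m
             map_mx (real_complex R) ((1%:M - B *m K) *m expmx (T *: A)) *m Q
           = N)
    (hbound : (complex.Re lambda`_1)^-1 *
                ln (opnorm2 (B *m K *m expmx (T *: A)) *
                    \sum_(0 <= k < n) opnorm2C N ^+ k) < mu) :
  synchronous A B K T mu gamma.
Proof.
move=> x0 x xsol i j.
(* With [n = 0] the norms are empty sums; the gain identity below needs [0 < n]. *)
have [n0|n_gt0] := posnP n.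
  rewrite [X in (X @ _)%classic](_ : _ = fun=> 0); first exact: cvg_cst.
  apply/funext => t; rewrite /norm2 big1 ?sqrtr0// => l _.
  by exfalso; have := leq_ltn_trans (leq0n l) (ltn_ord l); rewrite n0.
have KB : K *m B = 1%:M.
  apply: nilpotent_closed_loop_gain n_gt0 _ hnil.
  by have [] := mulmx1_unit (expmx_mulN (T *: A)).
pose X k := state_mx (x (k%:R * T)).
have X0 a : (X k a i - X k a j @[k --> \oo] --> 0)%classic.
  (* Writing [q] as [1 + m.+1] exposes the block of the reference unit and leaves a nonempty
     quotient. *)
  case: q hq gamma hgamma hgamma_diag htree heig x0 x xsol i j @X hbound =>
    // -[//|m] _ g g_ge0 g0 tree eig x0 x xsol i j X bound.
  apply: (@grounding_diff_cvg0 R m.+1 n X) => {}a l.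
  have {}bound : (complex.Re lambda`_1)^-1 * ln (opnorm2 (B *m K *m expmx (T *: A)) *
      \sum_(0 <= k < n) opnorm2C ((Q ^t*)%sesqui *m map_mx (real_complex R)
        ((1%:M - B *m K) *m expmx (T *: A)) *m Q) ^+ k) < mu by rewrite hQN.
  exact: (@discrete_synchronization R m.+1 n _ _ g mu lambda Q X isT hmu g_ge0 g0
    tree hnil eig hsort hQ bound (fun k => network_state_step hT xsol k KB) a l).
pose c := n%:R * expR (T * mx_l1 A).
have bnd0 : (c * (\sum_b `|X k b i - X k b j|) @[k --> \oo] --> 0)%classic.
  rewrite -[X in (_ --> X)%classic](mulr0 c); apply: cvgMl_tmp.
  by apply: cvg_bigsum0 => b _; apply/norm_cvg0P.
apply/cvgr0Pnorm_lt => eps eps0.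
have [k0 _ Hk] := (cvgr0Pnorm_lt _).1 bnd0 _ eps0.
near=> t.
have t0 : 0 <= t by near: t; exact: nbhs_pinfty_ge.
have k0t : k0%:R * T <= t by near: t; apply: nbhs_pinfty_ge; exact: num_real.
(* [k] indexes the last sampling time not after [t]. *)
pose k := Num.truncn (t / T).
have kt : k%:R * T <= t < k.+1%:R * T.
  by rewrite -ler_pdivlMr// -ltr_pdivrMr// truncn_itv// divr_ge0// ltW.
have kk0 : (k0 <= k)%N.
  by rewrite truncn_ge_nat ?divr_ge0 ?(ltW hT)// ler_pdivlMr.
rewrite ger0_norm ?norm2_ge0// (le_lt_trans (unit_diff_bound hT xsol i j kt))//.
exact: le_lt_trans (ler_norm _) (Hk k kk0).
Unshelve. all: by end_near. Qed.
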